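(* Let $F/k(x)$ be a cyclic extension of degree $p^n$ in which every ramified place is totally ramified, with Boseck invariants $\Gamma_k$, and let $P_i$ be the place of $F$ above a ramified place $(x-\alpha_i)$ of $k(x)$. If $\Gamma_k\ge 2$ for all $0\le k\le p^n-2$, then all the numbers $1,\ldots,p^n-1$ are gaps at $P_i$. If there are Boseck invariants $\Gamma_k=1$ ($0\le k\le p^n-2$), then the set of gaps at $P_i$ smaller than $p^n$ is exactly $$\{\rho_i^{(k)}+1 : 0\le k\le p^n-2,\ \Gamma_k\ge 2\}.$$
   Context: The constant field (also denoted $k$ in $k(x)$) is algebraically closed of characteristic $p>0$; $F$ is the function field of a projective nonsingular curve of genus $\ge 2$. The places of $k(x)$ ramified in $F$ are $(x-\alpha_1),\ldots,(x-\alpha_s)$ (all finite). There is a unique tower $k(x)=L_0\subset L_1\subset\cdots\subset L_n=F$ with $[L_j:L_{j-1}]=p$, and generators are chosen in standard form: $L_j=L_{j-1}(y_j)$, $y_j^p-y_j=B_j\in L_{j-1}$, $\mathrm{div}(B_j)=A-\sum_i\lambda_{i,j}P_{i,j-1}$ with $A$ effective and prime to the pole divisor of $B_j$, $P_{i,j}$ the place of $L_j$ above $(x-\alpha_i)$, and $\lambda_{i,j}=-v_{P_{i,j-1}}(B_j)=-v_{P_{i,j}}(y_j)$ zero or a positive integer prime to $p$. Let $\delta_i$ be the different exponent of $P_i=P_{i,n}$ over $(x-\alpha_i)$. For an integer $0\le k\le p^n-1$ with $p$-adic expansion $k=a_1^{(k)}+a_2^{(k)}p+\cdots+a_n^{(k)}p^{n-1}$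 set $\nu_{ik}=\left\lfloor \frac{\delta_i-\sum_{j=1}^n a_j^{(k)}\lambda_{i,j}p^{n-j}}{p^n}\right\rfloor$, $\ \Gamma_k=\sum_{i=1}^s\nu_{ik}$ (the Boseck invariants), and $\rho_i^{(k)}=\big(\delta_i-\sum_{j=1}^n a_j^{(k)}\lambda_{i,j}p^{n-j}\big)-\nu_{ik}p^n$. A gap at a place $Q$ is a positive integer $a$ such that no function has pole divisor $aQ$. *)

(* Defs.v *)
From HB Require Import structures.
From mathcomp Require Import all_boot all_order all_algebra all_fingroup.
From mathcomp Require Import all_solvable all_field.
From mathcomp Require Import boolp.
From mathcomp Require Import freeg zify.
Set Implicit Arguments.
Unset Strict Implicit.
Unset Printing Implicit Defensive.
Import Order.TTheory GRing.Theory Num.Theory.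
Local Open Scope ring_scope.

(* The rational function field k(x); the indeterminate x is 'X%:F. *)
Notation ratfun k := {fraction {poly k}}.

Section Places.
Variable k : closedFieldType.
Local Notation K := (ratfun k).

Definition const (E : fieldExtType K) (c : k) : E := (tofrac c%:P)%:A.

(* Places of a finite extension E of k(x), given by their normalized discrete
   valuations trivial on k. The value at 0, usually +oo, is fixed to 0 so that
   a place is determined by its valuation; consequently every statement about
   the valuation of f below must be read for f != 0. *)
Record place (E : fieldExtType K) := Place {
  val_at :> E -> int;
  val_at0 : val_at 0 = 0;
  val_atM : forall f g, f != 0 -> g != 0 ->
    val_at (f * g) = val_at f + val_at g;
  val_atD : forall f g, f != 0 -> g != 0 -> f + g != 0 ->
    Num.min (val_at f) (val_at g) <= val_at (f + g);
  val_at_const : forall c : k, c != 0 -> val_at (const E c) = 0;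
  val_at_onto : exists t, val_at t = 1 }.

HB.instance Definition _ (E : fieldExtType K) := gen_eqMixin (place E).
HB.instance Definition _ (E : fieldExtType K) := gen_choiceMixin (place E).

Section FinitePlace.
Variable a : k.

Definition finite_val (f : K) : int :=
  if f == 0 then 0 else
  (mup a \n_(generic_quotient.repr f))%:Z
    - (mup a \d_(generic_quotient.repr f))%:Z.

Lemma ratfunE (f : K) :
  f = tofrac \n_(generic_quotient.repr f) / tofrac \d_(generic_quotient.repr f).
Proof.
have d0 := denom_ratioP (generic_quotient.repr f).
apply: (canRL (mulfK _)); first by rewrite tofrac_eq0.
rewrite -{1}[f]generic_quotient.reprK.
set r := generic_quotient.repr f in d0 *.
unlock FracField.tofrac; rewrite -[LHS]FracField.pi_mul.
apply/eqP; rewrite generic_quotient.eqmodE /=.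
rewrite FracField.equivfE /FracField.mulf.
by rewrite !numden_Ratio ?mulf_neq0 ?mulr1 ?oner_neq0 // mulrC.
Qed.

Lemma ratfunP (f : K) : f != 0 ->
  exists m d : {poly k}, [/\ m != 0, d != 0 & f = tofrac m / tofrac d].
Proof.
move=> f0; exists \n_(generic_quotient.repr f), \d_(generic_quotient.repr f).
split; [|exact: denom_ratioP|exact: ratfunE].
by apply: contraNneq f0 => n0; rewrite (ratfunE f) n0 tofrac0 mul0r.
Qed.

Lemma finite_valE (m d : {poly k}) : m != 0 -> d != 0 ->
  finite_val (tofrac m / tofrac d) = (mup a m)%:Z - (mup a d)%:Z.
Proof.
move=> m0 d0; set f := tofrac m / _.
have f0 : f != 0 by rewrite mulf_neq0 ?invr_eq0 ?tofrac_eq0.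
have d'0 := denom_ratioP (generic_quotient.repr f).
have n'0 : \n_(generic_quotient.repr f) != 0.
  by apply: contraNneq f0 => n0; rewrite (ratfunE f) n0 tofrac0 mul0r.
have /eqP := ratfunE f; rewrite {1}/f eqr_div ?tofrac_eq0 //.
rewrite -!tofracM tofrac_eq => /eqP /(congr1 (mup a)).
rewrite !mupM // => /(congr1 Posz); rewrite !PoszD /finite_val (negPf f0) => e.
by apply/eqP; rewrite subr_eq addrAC eq_sym subr_eq e.
Qed.

Lemma finite_val0 : finite_val 0 = 0.
Proof. by rewrite /finite_val eqxx. Qed.

Lemma finite_val_poly (q : {poly k}) : q != 0 ->
  finite_val (tofrac q) = (mup a q)%:Z.
Proof.
move=> q0; rewrite -[tofrac q]divr1 -tofrac1 finite_valE ?oner_neq0 //.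
by rewrite [mup a 1]mupNroot ?subr0 // root1.
Qed.

Lemma finite_valM (f g : K) : f != 0 -> g != 0 ->
  finite_val (f * g) = finite_val f + finite_val g.
Proof.
move=> /ratfunP[m [d [m0 d0 ->]]] /ratfunP[m' [d' [m'0 d'0 ->]]].
rewrite mulf_div -!tofracM !finite_valE ?mulf_neq0 // !mupM // !PoszD.
by rewrite opprD addrACA.
Qed.

Lemma finite_valD (f g : K) : f != 0 -> g != 0 -> f + g != 0 ->
  Num.min (finite_val f) (finite_val g) <= finite_val (f + g).
Proof.
move=> /ratfunP[m [d [m0 d0 ->]]] /ratfunP[m' [d' [m'0 d'0 ->]]].
rewrite addf_div ?tofrac_eq0 // -!tofracM -tofracD => s0.
have {}s0 : m * d' + m' * d != 0.
  by apply: contraNneq s0 => ->; rewrite tofrac0 mul0r.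
rewrite !finite_valE ?mulf_neq0 // [mup a (d * d')]mupM // PoszD.
set t := mup a (m * d' + _).
have : (minn (mup a (m * d')) (mup a (m' * d)) <= t)%N.
  by rewrite /t mup_geq // dvdp_add // -mup_geq ?mulf_neq0 // ?geq_minl ?geq_minr.
rewrite !mupM // geq_min ge_min.
by case/orP => le; apply/orP; [left|right]; lia.
Qed.

Lemma finite_val_const (c : k) : c != 0 -> finite_val (const K^o c) = 0.
Proof.
move=> c0; rewrite /const /= [_%:A]mulr1 finite_val_poly ?polyC_eq0 //.
by rewrite mupNroot // rootC.
Qed.

Lemma finite_val_onto : exists t, finite_val t = 1.
Proof.
exists (tofrac ('X - a%:P)); rewrite finite_val_poly ?polyXsubC_eq0 //.
by rewrite -['X - _]expr1 mup_XsubCX eqxx.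
Qed.

Definition finite_place : place K^o :=
  @Place K^o finite_val finite_val0 finite_valM finite_valD
    finite_val_const finite_val_onto.

End FinitePlace.

Section Extensions.
Variable E : fieldExtType K.

(* Q lies over P exactly when, for some e > 0, its valuation restricts to e
   times that of P; this e is then the ramification index. *)
Definition ram_index (Q : place E) (P : place K^o) (e : nat) : Prop :=
  (0 < e)%N /\ forall f : K, Q f%:A = e%:Z * P f.

Definition lies_over (Q : place E) (P : place K^o) : Prop :=
  exists e, ram_index Q P e.

Definition ramified (P : place K^o) : Prop :=
  exists (Q : place E) (e : nat), ram_index Q P e /\ (1 < e)%N.

Definition totally_ramified (P : place K^o) : Prop :=
  exists Q : place E, ram_index Q P (\dim {:E}) /\
    forall Q', lies_over Q' P -> Q' = Q.

Definition riemann_roch (D : {freeg (place E)}) (f : E) : Prop :=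
  f = 0 \/ forall Q : place E, - coeff Q D <= Q f.

(* l is the dimension over k of the Riemann-Roch space of D. *)
Definition rr_dim (D : {freeg (place E)}) (l : nat) : Prop :=
  exists b : 'I_l -> E,
  [/\ forall i, riemann_roch D (b i),
      forall c : 'I_l -> k,
        \sum_i const E (c i) * b i = 0 -> forall i, c i = 0
    & forall f, riemann_roch D f ->
        exists c : 'I_l -> k, f = \sum_i const E (c i) * b i].

(* The genus is the maximum of deg D - l(D) + 1; places have degree 1 because
   k is algebraically closed, so that deg D is the sum of the coefficients. *)
Definition is_genus (g : nat) : Prop :=
  (forall D l, rr_dim D l -> deg D - l%:Z + 1 <= g%:Z) /\
  exists D l, rr_dim D l /\ deg D - l%:Z + 1 = g%:Z.

Definition pole_divisor_is (f : E) (D : {freeg (place E)}) : Prop :=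
  forall Q : place E, coeff Q D = Num.max 0 (- Q f).

Definition gap (Q : place E) (a : nat) : Prop :=
  (0 < a)%N /\ ~ exists f : E, f != 0 /\ pole_divisor_is f << a%:Z *g Q >>.

Definition integral_over (P : place K^o) (f : E) : Prop :=
  exists q : {poly K}, [/\ q \is monic, forall i, 0 <= P q`_i
    & root (map_poly (in_alg E) q) f].

End Extensions.

Section Different.
Variable F : splittingFieldType K.

(* Complementary module of F/k(x) at P; the trace is the Galois one, to be used
   when F/k(x) is Galois. *)
Definition complementary (P : place K^o) (z : F) : Prop :=
  forall w, integral_over P w ->
    exists c : K, galTrace 1%AS {:F}%AS (z * w) = c%:A /\ 0 <= P c.

(* The complementary module at P is t times the integral closure of the local
   ring of P, and the different exponent of Q over P is the order of 1/t. *)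
Definition different_exponent (Q : place F) (P : place K^o) (d : int) : Prop :=
  exists t : F, [/\ t != 0,
    forall z, complementary P z <-> integral_over P (z / t) & d = - Q t].

End Different.

Section Tower.
Variables (F : splittingFieldType K) (p n s : nat).

Definition tower (L : nat -> {subfield F}) : Prop :=
  [/\ L 0%N = 1%AS, L n = {:F}%AS
    & forall j, (j < n)%N -> (L j <= L j.+1)%VS /\ \dim_(L j) (L j.+1) = p].

(* The generators are indexed from 1 to n: y j generates L j over L j.-1.
   The values at 0 and beyond n of the families are irrelevant. Place i j is the
   place of L j above the i-th ramified place. *)
Record standard_form (L : nat -> {subfield F})
    (y : forall j, subvs_of (L j)) (B : forall j, subvs_of (L j.-1))
    (Pl : 'I_s -> forall j, place (subvs_of (L j)))
    (lambda : 'I_s -> nat -> nat) : Prop := StandardForm {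
  sf_gen : forall j, (j < n)%N -> <<L j; vsval (y j.+1)>>%VS = L j.+1;
  sf_eq : forall j, (j < n)%N ->
    vsval (y j.+1) ^+ p - vsval (y j.+1) = vsval (B j.+1);
  sf_neq0 : forall j, (j < n)%N -> B j.+1 != 0;
  sf_div : forall j, (j < n)%N ->
    exists A : {freeg (place (subvs_of (L j)))},
    [/\ fgle 0 A,
        forall Q : place (subvs_of (L j)),
          Q (B j.+1) =
          coeff Q (A - \sum_i << (lambda i j.+1)%:Z *g Pl i j >>)
      & forall Q : place (subvs_of (L j)), Q (B j.+1) < 0 -> coeff Q A = 0];
  sf_lambda : forall i j, (j < n)%N ->
    (lambda i j.+1)%:Z = - Pl i j (B j.+1) /\
    (lambda i j.+1)%:Z = - Pl i j.+1 (y j.+1);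
  sf_coprime : forall i j, (j < n)%N ->
    lambda i j.+1 = 0%N \/ coprime (lambda i j.+1) p }.

End Tower.
End Places.

Section Boseck.
Variables (p n s : nat) (delta : 'I_s -> int) (lambda : 'I_s -> nat -> nat).

(* The j-th digit of m, of weight p ^ j.-1, for 1 <= j <= n. *)
Definition digit (m j : nat) : nat := (m %/ p ^ j.-1 %% p)%N.

Definition boseck_num (i : 'I_s) (m : nat) : int :=
  delta i - (\sum_(1 <= j < n.+1) digit m j * lambda i j * p ^ (n - j))%N%:Z.

Definition nu (i : 'I_s) (m : nat) : int := (boseck_num i m %/ (p ^ n)%N%:Z)%Z.

Definition boseck (m : nat) : int := \sum_(i < s) nu i m.

Definition rho (i : 'I_s) (m : nat) : int :=
  boseck_num i m - nu i m * (p ^ n)%N%:Z.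

End Boseck.

(* Main.v *)
From HB Require Import structures.
Require Import Defs.
From mathcomp Require Import all_boot all_order all_algebra all_fingroup.
From mathcomp Require Import all_solvable all_field.
From mathcomp Require Import boolp.
From mathcomp Require Import freeg zify.
Set Implicit Arguments.
Unset Strict Implicit.
Unset Printing Implicit Defensive.
Import Order.TTheory GRing.Theory Num.Theory.
Local Open Scope ring_scope.

(** The proof avoids the Riemann-Roch theorem: it determines all functions whose
    only pole is at a given ramified place.

    Let y j be the Artin-Schreier generators and w m, for m < p ^ n with digits
    a j, the product of the y j ^ a j ([basis_elt]). At every ramified place P l
    the right-hand side of the j-th equation has pole order lambda l j prime to
    p, so each step of the tower multiplies the ramification index by p, and w m
    has pole order u_l(m), the sum of the a j * lambda l j * p ^ (n - j)
    ([generator_order], [basis_elt_val]). These numbers are distinct modulo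
    p ^ n, the ramification index. Hence the w m form a basis over k(x), and the
    order at P l of a combination is the least order of its terms ([basis_pge]).

    The trace form is triangular in this basis: with the digits of m and
    p ^ n - 1 - m being complementary, the trace of w m1 * w (p ^ n - 1 - m)
    vanishes for m1 < m and is a sign for m1 = m ([Tr_dual], [Tr_dual_lt]). This
    has two consequences. First, the different exponent at P l is u_l(p ^ n - 1)
    + p ^ n - 1 ([different_exponentE]). Second, over a place q of k(x) that is
    not ramified, the coefficients of a function that is regular above q are
    themselves regular at q ([coef_regular]). For this some place of F above q
    must exist, and it is built along the tower by solving the Artin-Schreier
    equations in the completion ([artin_schreier_place], [extend_to_top]).

    So a function with pole divisor a P l may be replaced by one of its terms
    c * w m, where c has poles at the ramified places only; the condition that
    such a c exists is that its prescribed orders at these places add up to at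
    most 0 ([nongap_coef], [nongap_construct]). By the formula for the
    different, the Boseck number of m' = p ^ n - 1 - m at l is u_l(m) +
    p ^ n - 1, so that nu l m' is the rounded up quotient of u_l(m) by p ^ n,
    and rho l m' + 1 is the residue of u_l(m) ([nu_rho_compl]). For a =
    rho l m' + 1 the prescribed orders are nu i m' for i other than l and
    nu l m' - 1 at l, whence a is a gap exactly when the Boseck invariant of m'
    is at least 2 ([gap_compl]). *)

(** * Orders at a place *)

Section PlaceTheory.
Variables (k : closedFieldType) (E : fieldExtType (ratfun k)).
Implicit Types (Q : place E) (f g : E) (N : int).

Lemma const_zmod_morphism : zmod_morphism (@const k E).
Proof. by move=> a b; rewrite /const polyCB rmorphB /= scalerBl. Qed.

Lemma const_monoid_morphism : monoid_morphism (@const k E).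
Proof.
split; first by rewrite /const polyC1 tofrac1 scale1r.
by move=> a b; rewrite /const polyCM rmorphM /= -scalerAl mul1r scalerA.
Qed.

HB.instance Definition _ :=
  GRing.isZmodMorphism.Build k E (@const k E) const_zmod_morphism.
HB.instance Definition _ :=
  GRing.isMonoidMorphism.Build k E (@const k E) const_monoid_morphism.

Lemma place_val1 Q : Q 1 = 0.
Proof. by rewrite -(rmorph1 (@const k E)) val_at_const ?oner_neq0. Qed.

Lemma place_valV Q f : Q f^-1 = - Q f.
Proof.
have [->|f0] := eqVneq f 0; first by rewrite invr0 val_at0.
by have := val_atM Q f0 (invr_neq0 f0); rewrite mulfV // place_val1; lia.
Qed.

Lemma place_val_div Q f g : f != 0 -> g != 0 ->
  f / g != 0 /\ Q (f / g) = Q f - Q g.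
Proof.
by move=> f0 g0; rewrite val_atM ?invr_eq0 // place_valV mulf_neq0 ?invr_eq0.
Qed.

Lemma place_valN Q f : Q (- f) = Q f.
Proof.
have [->|f0] := eqVneq f 0; first by rewrite oppr0.
have e : (-1 : E) = const E (-1) by rewrite rmorphN1.
by rewrite -mulN1r val_atM ?oppr_eq0 ?oner_eq0 // e val_at_const
           ?oppr_eq0 ?oner_eq0 // add0r.
Qed.

Lemma place_valX Q f m : Q (f ^+ m) = Q f *+ m.
Proof.
have [->|f0] := eqVneq f 0.
  by rewrite expr0n; case: m => [|m]; rewrite ?place_val1 ?val_at0 ?mul0rn.
elim: m => [|m IH]; first by rewrite expr0 place_val1.
by rewrite exprS val_atM ?expf_neq0 // IH mulrS.
Qed.

Lemma place_val_prod Q (I : finType) (x : I -> E) : (forall i, x i != 0) ->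
  Q (\prod_i x i) = \sum_i Q (x i).
Proof.
move=> x0.
suff: \prod_i x i != 0 /\ Q (\prod_i x i) = \sum_i Q (x i) by case.
apply: (big_rec2 (fun f N => f != 0 /\ Q f = N)) => [|i f N _ [f0 fN]].
  by rewrite oner_neq0 place_val1.
rewrite mulf_neq0 ?x0 ?f0 //; split=> //; rewrite val_atM ?x0 ?f0 //.
by rewrite fN.
Qed.

Lemma place_valXz Q f (z : int) : Q (f ^ z) = z * Q f.
Proof.
case: z => m; first by rewrite -exprnP place_valX -mulr_natl natz.
by rewrite NegzE -exprnN place_valV place_valX -mulr_natl natz mulNr.
Qed.

Lemma prodXz_neq0 (I : finType) (x : I -> E) (z : I -> int) :
  (forall i, x i != 0) -> \prod_i x i ^ z i != 0.
Proof. by move=> x0; apply/prodf_neq0 => i _; rewrite expfz_neq0. Qed.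

Lemma place_val_prodXz Q (I : finType) (x : I -> E) (z : I -> int) :
  (forall i, x i != 0) -> Q (\prod_i x i ^ z i) = \sum_i z i * Q (x i).
Proof.
move=> x0; rewrite place_val_prod => [|i]; last by rewrite expfz_neq0.
by apply: eq_bigr => i _; rewrite place_valXz.
Qed.

(** Membership in the fractional ideal of elements of order at least N at Q;
    unlike Q itself it treats 0 as an element of infinite order. *)
Definition pge Q N f : bool := (f == 0) || (N <= Q f).

Lemma pgeE Q N f : f != 0 -> pge Q N f = (N <= Q f).
Proof. by rewrite /pge => /negPf->. Qed.

Lemma pge0 Q N : pge Q N 0.
Proof. by rewrite /pge eqxx. Qed.

Lemma pgexx Q f : pge Q (Q f) f.
Proof. by rewrite /pge lexx orbT. Qed.

Lemma pgeW Q M N f : M <= N -> pge Q N f -> pge Q M f.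
Proof. by rewrite /pge => le /orP[->//|h]; rewrite (le_trans le h) orbT. Qed.

Lemma pgeD Q N f g : pge Q N f -> pge Q N g -> pge Q N (f + g).
Proof.
have [->|f0] := eqVneq f 0; first by rewrite add0r.
have [->|g0] := eqVneq g 0; first by rewrite addr0.
have [->|s0] := eqVneq (f + g) 0; first by rewrite pge0.
rewrite !pgeE // => hf hg; have := val_atD Q f0 g0 s0.
by apply: le_trans; rewrite le_min hf.
Qed.

Lemma pgeN Q N f : pge Q N (- f) = pge Q N f.
Proof. by rewrite /pge oppr_eq0 place_valN. Qed.

Lemma pgeB Q N f g : pge Q N f -> pge Q N g -> pge Q N (f - g).
Proof. by move=> hf hg; rewrite pgeD ?pgeN. Qed.

Lemma pgeM Q M N f g : pge Q M f -> pge Q N g -> pge Q (M + N) (f * g).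
Proof.
have [->|f0] := eqVneq f 0; first by rewrite mul0r !pge0.
have [->|g0] := eqVneq g 0; first by rewrite mulr0 !pge0.
by rewrite !pgeE ?mulf_neq0 // val_atM //; lia.
Qed.

Lemma pgeM0 Q f g : pge Q 0 f -> pge Q 0 g -> pge Q 0 (f * g).
Proof. by move=> hf hg; rewrite -(addr0 0) pgeM. Qed.

Lemma pge_const Q c : pge Q 0 (const E c).
Proof.
have [->|c0] := eqVneq c 0; first by rewrite rmorph0 pge0.
by rewrite /pge val_at_const // lexx orbT.
Qed.

Lemma pge_nat Q m : pge Q 0 m%:R.
Proof. by rewrite -(rmorph_nat (@const k E)) pge_const. Qed.

Lemma pgeX Q f m : pge Q 0 f -> pge Q 0 (f ^+ m).
Proof.
move=> hf; elim: m => [|m IH]; first exact: (pge_nat Q 1).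
by rewrite exprS pgeM0.
Qed.

Lemma pge_sum Q N (I : Type) (r : seq I) (A : pred I) (x : I -> E) :
  (forall i, A i -> pge Q N (x i)) -> pge Q N (\sum_(i <- r | A i) x i).
Proof.
move=> h; elim/big_ind: _ => //; [exact: pge0|].
by move=> a b; apply: pgeD.
Qed.

Lemma pge_prod Q (I : Type) (r : seq I) (A : pred I) (x : I -> E) :
  (forall i, A i -> pge Q 0 (x i)) -> pge Q 0 (\prod_(i <- r | A i) x i).
Proof.
move=> h; elim/big_ind: _ => //; first exact: (pge_nat Q 1).
by move=> a b; apply: pgeM0.
Qed.

Lemma place_val_eq Q N f : pge Q N f -> ~~ pge Q (N + 1) f -> Q f = N.
Proof. by rewrite /pge negb_or; case: eqP => //= _; lia. Qed.

Lemma place_val_dom Q f g : f != 0 -> pge Q (Q f + 1) g ->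
  f + g != 0 /\ Q (f + g) = Q f.
Proof.
move=> f0 hg.
have hf : ~~ pge Q (Q f + 1) f by rewrite pgeE //; lia.
have hs : ~~ pge Q (Q f + 1) (f + g).
  by apply: contra hf => hs; have := pgeB hs hg; rewrite addrK.
split; first by apply: contraNneq hs => ->; rewrite pge0.
apply: place_val_eq => //; apply: pgeD; first exact: pgexx.
by apply: pgeW hg; lia.
Qed.

(** The strict triangle inequality forces the summand of least order to
    dominate as soon as no two summands have the same order. *)
Lemma pge_sum_distinct Q N (I : finType) (x : I -> E) :
  (forall i j, x i != 0 -> x j != 0 -> Q (x i) = Q (x j) -> i = j) ->
  pge Q N (\sum_i x i) -> forall i, pge Q N (x i).
Proof.
move=> inj hs i; have [->|xi0] := eqVneq (x i) 0; first exact: pge0.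
pose A := [pred j | x j != 0].
case: (arg_minP (fun j => Q (x j)) (xi0 : A i)) => j /= xj0 jmin.
suff: pge Q N (x j).
  by rewrite !pgeE // => /le_trans; apply; apply: jmin.
have [] := @place_val_dom Q (x j) (\sum_(l | l != j) x l) xj0.
  apply: pge_sum => l lj; have [->|xl0] := eqVneq (x l) 0; first exact: pge0.
  rewrite pgeE //; have := jmin l xl0.
  have : Q (x j) <> Q (x l) by move=> /inj e; case/eqP: lj; rewrite -e.
  by lia.
have -> : x j + \sum_(l | l != j) x l = \sum_i x i by rewrite [RHS](bigD1 j).
move=> s0 e.
by move: hs; rewrite !pgeE // e.
Qed.

End PlaceTheory.

(** * Places of the rational function field *)

Section RationalPlaces.
Variable k : closedFieldType.
Local Notation K := (ratfun k).
Implicit Types (f g : K) (m d : {poly k}).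

Lemma ratfun_coprimeP f : f != 0 -> exists m d,
  [/\ m != 0, d != 0, coprimep m d & f = tofrac m / tofrac d].
Proof.
move=> /ratfunP[m [d [m0 d0 ->]]].
have em := divpK (dvdp_gcdl m d); have ed := divpK (dvdp_gcdr m d).
set g := gcdp m d in em ed *.
have g0 : g != 0 by rewrite gcdp_eq0 negb_and m0.
have m'0 : m %/ g != 0 by apply: contraNneq m0 => e; rewrite -em e mul0r.
have d'0 : d %/ g != 0 by apply: contraNneq d0 => e; rewrite -ed e mul0r.
exists (m %/ g), (d %/ g); split=> //.
  by apply: coprimep_div_gcd; rewrite m0.
by rewrite -{1}em -{1}ed !tofracM -mulf_div mulfV ?tofrac_eq0 ?mulr1.
Qed.

Lemma constK (c : k) : const K^o c = tofrac c%:P.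
Proof. by rewrite /const /= [_%:A]mulr1. Qed.

Definition degp (m : {poly k}) : nat := (size m).-1.

Lemma degpM m d : m != 0 -> d != 0 -> degp (m * d) = (degp m + degp d)%N.
Proof.
move=> m0 d0; rewrite /degp size_mul //; move: m0 d0; rewrite -!size_poly_gt0.
by case: (size m) => // a; case: (size d) => // b _ _; rewrite addSn addnS.
Qed.

Lemma degpD m d : (degp (m + d) <= maxn (degp m) (degp d))%N.
Proof.
have := size_polyD m d; rewrite /degp !leq_max.
by case: (size (m + d)) (size m) (size d) => [|a] [|b] [|c] //=; lia.
Qed.

Lemma ltn_degp (r : {poly k}) N : r != 0 -> (size r <= N)%N -> (degp r < N)%N.
Proof. by rewrite -size_poly_gt0 /degp; case: (size r). Qed.

Lemma degpC (c : k) : degp c%:P = 0.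
Proof. by rewrite /degp size_polyC; case: (c != 0). Qed.

Definition infinite_val f : int :=
  if f == 0 then 0 else
  (degp \d_(generic_quotient.repr f))%:Z
    - (degp \n_(generic_quotient.repr f))%:Z.

Lemma infinite_valE m d : m != 0 -> d != 0 ->
  infinite_val (tofrac m / tofrac d) = (degp d)%:Z - (degp m)%:Z.
Proof.
move=> m0 d0; set f := tofrac m / _.
have f0 : f != 0 by rewrite mulf_neq0 ?invr_eq0 ?tofrac_eq0.
have d'0 := denom_ratioP (generic_quotient.repr f).
have n'0 : \n_(generic_quotient.repr f) != 0.
  by apply: contraNneq f0 => n0; rewrite (ratfunE f) n0 tofrac0 mul0r.
have /eqP := ratfunE f; rewrite {1}/f eqr_div ?tofrac_eq0 //.
rewrite -!tofracM tofrac_eq => /eqP /(congr1 degp).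
by rewrite !degpM // /infinite_val (negPf f0); lia.
Qed.

Lemma infinite_val0 : infinite_val 0 = 0.
Proof. by rewrite /infinite_val eqxx. Qed.

Lemma infinite_valM f g : f != 0 -> g != 0 ->
  infinite_val (f * g) = infinite_val f + infinite_val g.
Proof.
move=> /ratfunP[m [d [m0 d0 ->]]] /ratfunP[m' [d' [m'0 d'0 ->]]].
rewrite mulf_div -!tofracM !infinite_valE ?mulf_neq0 // !degpM //; lia.
Qed.

Lemma infinite_valD f g : f != 0 -> g != 0 -> f + g != 0 ->
  Num.min (infinite_val f) (infinite_val g) <= infinite_val (f + g).
Proof.
move=> /ratfunP[m [d [m0 d0 ->]]] /ratfunP[m' [d' [m'0 d'0 ->]]].
rewrite addf_div ?tofrac_eq0 // -!tofracM -tofracD => s0.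
have {}s0 : m * d' + m' * d != 0.
  by apply: contraNneq s0 => ->; rewrite tofrac0 mul0r.
rewrite !infinite_valE ?mulf_neq0 //.
have := degpD (m * d') (m' * d); set t := degp (m * d' + _).
rewrite !degpM // leq_max ge_min.
by case/orP => le; apply/orP; [left|right]; lia.
Qed.

Lemma infinite_val_const (c : k) : c != 0 -> infinite_val (const K^o c) = 0.
Proof.
move=> c0; rewrite constK -[tofrac _]divr1 -tofrac1.
by rewrite infinite_valE ?polyC_eq0 ?oner_eq0 // !degpC.
Qed.

Lemma infinite_val_onto : exists t, infinite_val t = 1.
Proof.
exists (tofrac 1 / tofrac 'X).
by rewrite infinite_valE ?polyX_eq0 ?oner_eq0 // degpC /degp size_polyX.
Qed.

Definition infinite_place : place K^o :=
  @Place k K^o infinite_val infinite_val0 infinite_valM infinite_valD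
    infinite_val_const infinite_val_onto.

Lemma mup_gt0 (b : k) m : m != 0 -> (0 < mup b m)%N = root m b.
Proof. by move=> m0; rewrite -XsubC_dvd // dvdp_XsubCl. Qed.

(** The residue field of Q is k, said without forming that field. *)
Definition constant_residues (E : fieldExtType K) (Q : place E) : Prop :=
  forall f : E, pge Q 0 f -> exists c, pge Q 1 (f - const E c).

Lemma finite_place_residues (b : k) : constant_residues (finite_place b).
Proof.
move=> f; have [->|f0] := eqVneq f 0.
  by exists 0; rewrite rmorph0 subr0 pge0.
case: (ratfun_coprimeP f0) => m [d [m0 d0 md ->{f f0}]].
rewrite /pge mulf_eq0 invr_eq0 !tofrac_eq0 (negPf m0) (negPf d0) /=.
rewrite finite_valE // => h.
have dNr : ~~ root d b.
  apply/negP => rd; have rm : ~~ root m b.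
    by apply/negP => /(coprimep_root md)/negP; apply.
  by move: h; rewrite (mupNroot rm); move: rd; rewrite -mup_gt0 //; lia.
have db : d.[b] != 0 by [].
pose c := m.[b] / d.[b]; exists c; rewrite constK.
have -> : tofrac m / tofrac d - tofrac c%:P =
    tofrac (m - c%:P * d) / tofrac d :> K.
  by rewrite tofracB tofracM mulrBl mulfK ?tofrac_eq0.
have [->|e0] := eqVneq (m - c%:P * d) 0; first by rewrite tofrac0 mul0r eqxx.
rewrite finite_valE // (mupNroot dNr) subr0; apply/orP; right.
have : root (m - c%:P * d) b by rewrite /root !hornerE /= divfK ?subrr.
by rewrite -mup_gt0.
Qed.

Lemma infinite_place_residues : constant_residues infinite_place.
Proof.
move=> f; have [->|f0] := eqVneq f 0.
  by exists 0; rewrite rmorph0 subr0 pge0.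
case: (ratfunP f0) => m [d [m0 d0 ->{f f0}]].
rewrite /pge mulf_eq0 invr_eq0 !tofrac_eq0 (negPf m0) (negPf d0) /=.
rewrite infinite_valE // => h.
pose c := m`_(degp d) / lead_coef d; exists c; rewrite constK.
have -> : tofrac m / tofrac d - tofrac c%:P =
    tofrac (m - c%:P * d) / tofrac d :> K.
  by rewrite tofracB tofracM mulrBl mulfK ?tofrac_eq0.
have [->|e0] := eqVneq (m - c%:P * d) 0; first by rewrite tofrac0 mul0r eqxx.
rewrite infinite_valE //; apply/orP; right.
have sd : size d = (degp d).+1 by rewrite /degp prednK ?size_poly_gt0.
have sm : size m = (degp m).+1 by rewrite /degp prednK ?size_poly_gt0.
suff : (degp (m - c%:P * d) < degp d)%N by lia.
apply: ltn_degp => //; apply/leq_sizeP => j.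
rewrite coefB coefCM leq_eqVlt => /orP[/eqP<-|lj].
  by rewrite /c divfK ?lead_coef_eq0 ?subrr.
by rewrite !nth_default ?mulr0 ?subrr ?sd ?sm //; lia.
Qed.

Lemma finite_val_lin (a b : k) :
  finite_place b (tofrac ('X - a%:P)) = (a == b)%:Z.
Proof.
rewrite /= finite_val_poly ?polyXsubC_eq0 //.
by rewrite -['X - _]expr1 mup_XsubCX; case: eqP.
Qed.

Lemma infinite_val_lin (a : k) : infinite_place (tofrac ('X - a%:P)) = -1.
Proof.
rewrite /= -[tofrac _]divr1 -tofrac1.
by rewrite infinite_valE ?polyXsubC_eq0 ?oner_eq0 // degpC /degp size_XsubC.
Qed.

Lemma infinite_val_le0 (f : K^o) : f != 0 ->
  (forall b : k, 0 <= finite_place b f) -> infinite_place f <= 0.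
Proof.
move=> f0; case: (ratfun_coprimeP f0) => m [d [m0 d0 md ->{f f0}]] h.
have sd : size d = 1.
  apply/eqP; apply: contraT => /closed_rootP[b rb].
  have rm : ~~ root m b.
    by apply/negP => /(coprimep_root md)/negP; apply.
  have := h b; rewrite /= finite_valE // (mupNroot rm).
  by move: rb; rewrite -mup_gt0 //; lia.
rewrite /= infinite_valE // [degp d]/degp sd; lia.
Qed.

(** All orders of a rational function add up to zero; dividing f by its linear
    factors at the points alpha i reduces this to a polynomial. *)
Lemma sum_finite_val_le0 (s : nat) (alpha : 'I_s -> k) (f : K^o) :
  injective alpha -> f != 0 ->
  (forall b : k, (forall i, b != alpha i) -> 0 <= finite_place b f) ->
  0 <= infinite_place f -> \sum_i finite_place (alpha i) f <= 0.
Proof.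
move=> alpha_inj f0 fin inf.
pose N i : int := finite_place (alpha i) f.
pose l i : K^o := tofrac ('X - (alpha i)%:P).
have l0 i : l i != 0 by rewrite tofrac_eq0 polyXsubC_eq0.
have [h [h0 hQ]] : exists h : K^o, h != 0 /\
    forall Q : place K^o, Q h = \sum_i N i * Q (l i).
  exists (\prod_i l i ^ N i).
  by split=> [|Q]; [exact: prodXz_neq0 | exact: place_val_prodXz].
have fh (Q : place K^o) : f / h != 0 /\ Q (f / h) = Q f - Q h.
  exact: (@place_val_div k K^o Q f h f0 h0).
have := @infinite_val_le0 (f / h) (fh infinite_place).1.
rewrite (fh infinite_place).2 hQ => H.
have : \sum_i N i * infinite_place (l i) = - \sum_i N i.
  rewrite -sumrN; apply: eq_bigr => i _.
  by rewrite infinite_val_lin mulrN1.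
move: H => /[swap] ->; rewrite opprK => H.
suff : infinite_place f + \sum_i N i <= 0 by rewrite /N; lia.
apply: H => b; rewrite (fh _).2 hQ.
under eq_bigr do rewrite finite_val_lin.
have [/existsP[i /eqP ->]|nb] := boolP [exists i, b == alpha i].
  rewrite (bigD1 i) //= big1 => [|j ji].
    by rewrite eqxx mulr1 addr0 subrr.
  by rewrite (inj_eq alpha_inj) (negPf ji) mulr0.
rewrite big1 => [|i _]; last first.
  suff -> : alpha i == b = false by rewrite mulr0.
  by apply: contraNF nb => /eqP e; apply/existsP; exists i; rewrite e.
rewrite subr0; apply: fin => i.
by apply: contraNneq nb => e; apply/existsP; exists i; rewrite e.
Qed.

End RationalPlaces.

(** * Extension of a place along an integral Artin-Schreier equation *)

Section Lipschitz.
Variables (k : closedFieldType) (E : fieldExtType (ratfun k)) (Q : place E).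

(** For integral x and z the difference q(x) - q(z) is x - z times an integral
    combination of the coefficients of q; C bounds their denominators. *)
Lemma horner_lipschitz (q : {poly E}) : exists C : nat,
  forall (x z : E) (N : int), pge Q 0 x -> pge Q 0 z -> pge Q N (x - z) ->
    pge Q (- C%:Z) q.[x] /\ pge Q (N - C%:Z) (q.[x] - q.[z]).
Proof.
elim/poly_ind: q => [|q c [C hC]].
  by exists 0 => x z N _ _ _; rewrite !horner0 !subr0 !pge0.
have [D [DC Dc]] : exists D : nat, (C <= D)%N /\ - D%:Z <= Q c.
  by exists (maxn C `|Q c|); clear; split; lia.
exists D => x z N hx hz h.
have [h1 h2] := hC x z N hx hz h.
have h' : pge Q N (z - x) by rewrite -pgeN opprB.
have [h3 _] := hC z x N hz hx h'.
have D1 : - D%:Z <= - C%:Z + 0 by clear -DC; lia.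
have D2 : N - D%:Z <= N - C%:Z + 0 by clear -DC; lia.
have D3 : N - D%:Z <= - C%:Z + N by clear -DC; lia.
rewrite !hornerMXaddC; split.
  by apply: pgeD; [apply: pgeW (pgeM h1 hx) | apply: pgeW (pgexx Q c)].
have -> : q.[x] * x + c - (q.[z] * z + c) =
   (q.[x] - q.[z]) * x + q.[z] * (x - z).
  by rewrite opprD addrACA subrr addr0 mulrBl mulrBr addrA subrK.
by apply: pgeD; [apply: pgeW (pgeM h2 hx) | apply: pgeW (pgeM h3 h)].
Qed.

End Lipschitz.

Section ArtinSchreierExtension.
Variables (k : closedFieldType) (p : nat) (charp : p \in [pchar k]).
Local Notation K := (ratfun k).
Variables (E M : fieldExtType K) (iota : {rmorphism E -> M}).
Hypothesis iota_const : forall c, iota (const E c) = const M c.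
Variables (Q : place E) (B : E) (y : M).
Hypothesis resQ : constant_residues Q.
Hypothesis B_int : pge Q 0 B.
Hypothesis yE : y ^+ p - y = iota B.

Local Notation A := ('X^p - 'X - B%:P).
Local Notation at_y q := (map_poly iota q).[y].

Hypothesis gen_y : forall f : M, exists q : {poly E}, f = at_y q.
Hypothesis min_y : forall q : {poly E}, at_y q = 0 -> A %| q.

Let prime_p : prime p := pcharf_prime charp.

Lemma pchar_ext (L : fieldExtType K) : p \in [pchar L].
Proof. exact: (rmorph_pchar (@const k L) charp). Qed.

Lemma expp_sub (L : fieldExtType K) (a b : L) : (a - b) ^+ p = a ^+ p - b ^+ p.
Proof.
exact: (rmorphB (pFrobenius_aut (pchar_ext L)) a b).
Qed.

Lemma pge_pow N (f : E) : 0 <= N -> pge Q N f -> pge Q (N + N) (f ^+ p).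
Proof.
move=> N0 hf; case: p (prime_gt1 prime_p) => [|[|m]] // _.
rewrite !exprS mulrA -(addr0 (N + N)) pgeM ?pgeM // pgeX //.
exact: pgeW hf.
Qed.

Lemma artin_schreier_residue : exists c : k,
  pge Q 1 (const E c ^+ p - const E c - B).
Proof.
have [b hb] := resQ B_int.
have : size ('X^p - 'X - b%:P : {poly k}) != 1.
  have p1 := prime_gt1 prime_p.
  rewrite -addrA size_polyDl size_polyXn -?[p.+1]/(p.+1) //.
    by rewrite eqSS; case: p p1.
  rewrite -opprD size_polyN (leq_ltn_trans (size_polyD _ _)) // size_polyX.
  by rewrite size_polyC; case: (b != 0) => /=; lia.
case/closed_rootP => c; rewrite rootE !hornerE /= => /eqP e.
exists c; rewrite -pgeN.
suff -> : - (const E c ^+ p - const E c - B) = B - const E b by [].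
rewrite opprB; congr (_ - _); apply/eqP.
by rewrite -rmorphXn -rmorphB /= -subr_eq0 -rmorphB /= e rmorph0.
Qed.

Variable c0 : k.
Hypothesis c0P : pge Q 1 (const E c0 ^+ p - const E c0 - B).

(** Successive approximations of the root of 'X^p - 'X - B in the completion
    of E at Q. *)
Fixpoint approx n : E :=
  if n is m.+1 then approx m ^+ p - B else const E c0.

Lemma approx_int n : pge Q 0 (approx n).
Proof.
elim: n => [|n IH] /=; first exact: pge_const.
by rewrite pgeB // pgeX.
Qed.

(** The Frobenius turns each error term into its p-th power. *)
Lemma approx_step n : pge Q n.+1%:Z (approx n.+1 - approx n).
Proof.
elim: n => [|n IH]; first by rewrite /= addrAC.
suff -> : approx n.+2 - approx n.+1 = (approx n.+1 - approx n) ^+ p.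
  by apply: pgeW (pge_pow _ IH) => //; lia.
by rewrite expp_sub /= opprB addrA subrK.
Qed.

Lemma approx_A n : A.[approx n] = approx n.+1 - approx n.
Proof. by rewrite !hornerE /= addrAC. Qed.

Lemma horner_approx (q : {poly E}) : exists C : nat, forall n,
  pge Q (- C%:Z) q.[approx n] /\
  pge Q (n.+1%:Z - C%:Z) (q.[approx n.+1] - q.[approx n]).
Proof.
have [C hC] := horner_lipschitz Q q; exists C => n.
have [_ h2] := hC _ _ _ (approx_int n.+1) (approx_int n) (approx_step n).
split=> //.
have [] // := hC (approx n) (approx n) 0 _ _ _; rewrite ?approx_int //.
by rewrite subrr pge0.
Qed.

(** The order at Q of the value of q at the root of 'X^p - 'X - B in the
    completion. *)
Definition stable_val (q : {poly E}) (v : int) : Prop := exists n0, forall n,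
  (n0 <= n)%N -> q.[approx n] != 0 /\ Q q.[approx n] = v.

Lemma at_yA : at_y A = 0.
Proof.
by rewrite !rmorphB /= map_polyXn map_polyX map_polyC !hornerE /= yE subrr.
Qed.

Lemma coprime_A (q : {poly E}) : at_y q != 0 -> coprimep q A.
Proof.
move=> q0; have A0 : A != 0.
  have p1 := prime_gt1 prime_p.
  rewrite -size_poly_gt0 -addrA size_polyDl size_polyXn //.
  rewrite -opprD size_polyN (leq_ltn_trans (size_polyD _ _)) // size_polyX.
  by rewrite size_polyC; case: (B != 0) => /=; lia.
have eA := divpK (dvdp_gcdr q A); have eq := divpK (dvdp_gcdl q A).
rewrite /coprimep; set d := gcdp q A in eA eq *.
have d0 : d != 0 by apply: contraNneq A0 => e; rewrite -eA e mulr0.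
have e0 : A %/ d != 0 by apply: contraNneq A0 => e; rewrite -eA e mul0r.
have : at_y (A %/ d) = 0.
  have := at_yA; rewrite -[X in map_poly _ X]eA rmorphM hornerM.
  move/eqP; rewrite mulf_eq0 => /orP[/eqP//|/eqP h].
  by case/eqP: q0; rewrite -eq rmorphM hornerM h mulr0.
move=> /min_y /(dvdp_leq e0); rewrite -{1}eA size_mul //.
move: d0 e0; rewrite -!size_poly_gt0.
case: (size (A %/ d)) => // b; case: (size d) => [|[|a]] // _ _.
by rewrite addSn /= !addnS ltnS ltnNge leq_addr.
Qed.

(** In a Bezout relation u * q + w * A = 1 the second term tends to 0 at the
    approximations, so the values of q cannot tend to 0. *)
Lemma stable_val_exists (q : {poly E}) :
  at_y q != 0 -> exists v, stable_val q v.
Proof.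
move=> /coprime_A /Bezout_eq1_coprimepP[[u w] /= uw].
have [Cu hu] := horner_approx u; have [Cw hw] := horner_approx w.
have [C hC] := horner_approx q.
pose n0 := (Cw + C + Cu)%N.
have bnd n : (n0 <= n)%N -> ~~ pge Q (Cu.+1)%:Z q.[approx n].
  move=> ln; apply/negP => h.
  have : pge Q 1 1.
    have <- : (u * q + w * A).[approx n] = 1 by rewrite uw hornerE.
    rewrite hornerD hornerM [(w * _).[_]]hornerM approx_A; apply: pgeD.
      by have := pgeM (hu n).1 h; apply: pgeW; lia.
    have := pgeM (hw n).1 (approx_step n).
    by apply: pgeW; rewrite /n0 in ln; lia.
  by rewrite pgeE ?oner_eq0 // place_val1.
have nz n : (n0 <= n)%N -> q.[approx n] != 0.
  by move=> /bnd; apply: contraNneq => ->; apply: pge0.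
exists (Q q.[approx n0]), n0 => n /subnKC <-; split; first exact/nz/leq_addr.
elim: (n - n0)%N => [|m IH]; first by rewrite addn0.
have ln := leq_addr m n0.
rewrite addnS -IH; have -> : q.[approx (n0 + m).+1] = q.[approx (n0 + m)] +
    (q.[approx (n0 + m).+1] - q.[approx (n0 + m)]) by rewrite addrC subrK.
have [] // := @place_val_dom _ _ Q q.[approx (n0 + m)]
  (q.[approx (n0 + m).+1] - q.[approx (n0 + m)]) (nz _ ln).
apply: pgeW (hC _).2.
by have := bnd _ ln; rewrite pgeE ?nz // /n0; lia.
Qed.

Lemma stable_val_unique (q1 q2 : {poly E}) v1 v2 : at_y q1 = at_y q2 ->
  stable_val q1 v1 -> stable_val q2 v2 -> v1 = v2.
Proof.
move=> e [n1 h1] [n2 h2].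
have /dvdpP[h eh] : A %| q2 - q1.
  by apply: min_y; rewrite rmorphB hornerD hornerN e subrr.
have [C hC] := horner_approx h.
pose n := (n1 + n2 + C + `|v1|)%N.
have [a1 b1] := h1 n ltac:(rewrite /n; lia).
have [a2 b2] := h2 n ltac:(rewrite /n; lia).
rewrite -b1 -b2; have -> : q2 = q1 + h * A by rewrite -eh addrC subrK.
rewrite hornerD.
have [] // := @place_val_dom _ _ Q q1.[approx n] (h * A).[approx n] a1.
rewrite hornerM approx_A; have := pgeM (hC n).1 (approx_step n).
by apply: pgeW; rewrite b1 /n; lia.
Qed.

Lemma stable_valM q1 q2 v1 v2 : stable_val q1 v1 -> stable_val q2 v2 ->
  stable_val (q1 * q2) (v1 + v2).
Proof.
move=> [n1 h1] [n2 h2]; exists (n1 + n2)%N => n ln.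
have [a1 b1] := h1 n ltac:(lia); have [a2 b2] := h2 n ltac:(lia).
by rewrite hornerM mulf_neq0 // val_atM // b1 b2.
Qed.

Lemma stable_valC (x : E) : x != 0 -> stable_val x%:P (Q x).
Proof. by move=> x0; exists 0 => n _; rewrite hornerC. Qed.

(** A place of E at which B is integral extends to a place of M, without
    ramification and without change of the residue field: M embeds in the
    completion of E, where Hensel's lemma provides the root y. *)
Lemma artin_schreier_place_from_residue : exists V : place M,
  (forall x, V (iota x) = Q x) /\ constant_residues V.
Proof.
have /choice[V hV] : forall f : M, exists v : int, (f = 0 -> v = 0) /\
    forall q, f != 0 -> at_y q = f -> stable_val q v.
  move=> f; have [->|f0] := eqVneq f 0; first by exists 0; split.
  have [q eq] := gen_y f.
  have [v hv] : exists v, stable_val q v.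
    by apply: stable_val_exists; rewrite -eq.
  exists v; split=> [/eqP|q' _ eq']; first by rewrite (negPf f0).
  have [v' hv'] : exists v, stable_val q' v.
    by apply: stable_val_exists; rewrite eq'.
  by rewrite (@stable_val_unique q q' v v') // eq' -eq.
have V0 : V 0 = 0 by apply: (hV 0).1.
have VE f q v : f != 0 -> at_y q = f -> stable_val q v -> V f = v.
  by move=> f0 e; apply: stable_val_unique ((hV f).2 q f0 e).
have Vi x : V (iota x) = Q x.
  have [->|x0] := eqVneq x 0; first by rewrite rmorph0 V0 val_at0.
  apply: (VE _ x%:P); rewrite ?fmorph_eq0 //; last exact: stable_valC.
  by rewrite map_polyC hornerC.
have VM f g : f != 0 -> g != 0 -> V (f * g) = V f + V g.
  move=> f0 g0; have [q eq] := gen_y f; have [r er] := gen_y g.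
  apply: (VE _ (q * r)); rewrite ?mulf_neq0 //.
    by rewrite rmorphM hornerM -eq -er.
  by apply: stable_valM; [apply: (hV f).2 | apply: (hV g).2].
have VD f g : f != 0 -> g != 0 -> f + g != 0 ->
    Num.min (V f) (V g) <= V (f + g).
  move=> f0 g0 s0; have [q eq] := gen_y f; have [r er] := gen_y g.
  have [n1 h1] := (hV f).2 q f0 (esym eq).
  have [n2 h2] := (hV g).2 r g0 (esym er).
  have [n3 h3] : stable_val (q + r) (V (f + g)).
    by apply: (hV _).2 => //; rewrite rmorphD hornerD -eq -er.
  pose n := (n1 + n2 + n3)%N.
  have [a1 <-] := h1 n ltac:(by rewrite /n -addnA leq_addr).
  have [a2 <-] := h2 n ltac:(by rewrite /n addnAC leq_addl).
  have [a3 <-] := h3 n (leq_addl _ _).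
  by rewrite hornerD in a3 *; apply: val_atD.
have Vc c : c != 0 -> V (const M c) = 0.
  by move=> c0'; rewrite -iota_const Vi val_at_const.
have Vo : exists t, V t = 1.
  by have [t <-] := val_at_onto Q; exists (iota t); rewrite Vi.
exists (Place V0 VM VD Vc Vo); split=> // f.
have [->|f0] := eqVneq f 0.
  by exists 0; rewrite rmorph0 subr0 pge0.
rewrite pgeE //= => Vf.
have [q eq] := gen_y f; have [n1 h1] := (hV f).2 q f0 (esym eq).
have [C hC] := horner_approx q; pose n := (n1 + C)%N.
have [c hc] : exists c, pge Q 1 (q.[approx n] - const E c).
  apply: resQ; have [a b] := h1 n (leq_addr _ _).
  by rewrite pgeE // b.
have stab m : pge Q 1 (q.[approx (n + m)] - const E c).
  elim: m => [|m IH]; first by rewrite addn0.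
  rewrite addnS; have -> : q.[approx (n + m).+1] - const E c =
      (q.[approx (n + m).+1] - q.[approx (n + m)]) +
      (q.[approx (n + m)] - const E c) by rewrite addrA subrK.
  apply: pgeD => //.
  by apply: pgeW (hC _).2; rewrite /n; lia.
exists c; have [->|e0] := eqVneq (f - const M c) 0; first exact: pge0.
rewrite pgeE //=.
have [n2 h2] : stable_val (q - (const E c)%:P) (V (f - const M c)).
  apply: (hV _).2 => //.
  rewrite rmorphB hornerD hornerN -eq; congr (_ - _).
  by rewrite /= map_polyC hornerC /=; exact: iota_const.
have [a <-] := h2 (n + n2)%N (leq_addl _ _).
by move: (stab n2); rewrite hornerD hornerN hornerC in a *; rewrite pgeE.
Qed.

End ArtinSchreierExtension.

Lemma artin_schreier_place (k : closedFieldType) (p : nat)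
    (E M : fieldExtType (ratfun k)) (iota : {rmorphism E -> M})
    (Q : place E) (B : E) (y : M) :
  p \in [pchar k] ->
  (forall c, iota (const E c) = const M c) ->
  constant_residues Q -> pge Q 0 B -> y ^+ p - y = iota B ->
  (forall f : M, exists q : {poly E}, f = (map_poly iota q).[y]) ->
  (forall q : {poly E}, (map_poly iota q).[y] = 0 -> 'X^p - 'X - B%:P %| q) ->
  exists V : place M, (forall x, V (iota x) = Q x) /\ constant_residues V.
Proof.
move=> charp ic res Bi yE gen min.
have [c hc] := artin_schreier_residue charp res Bi.
exact: (artin_schreier_place_from_residue charp ic res Bi yE gen min hc).
Qed.

(** * The trace in a cyclic tower of Artin-Schreier extensions *)

Section PowerSums.
Variables (F : fieldType) (p : nat) (charF : p \in [pchar F]).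

Let prime_p : prime p := pcharf_prime charF.

Lemma natr_pow_p (m : nat) : (m%:R : F) ^+ p = m%:R.
Proof. exact: (pFrobenius_aut_nat charF m). Qed.

Lemma natr_eq_mod (i j : nat) : (i < p)%N -> (j < p)%N ->
  i%:R = j%:R :> F -> i = j.
Proof.
wlog ij : i j / (i <= j)%N.
  by move=> h ip jp e; case: (leqP i j) => [|/ltnW] le; [|apply/esym]; apply: h.
move=> ip jp /eqP; rewrite eq_sym -subr_eq0 -natrB // -(dvdn_pcharf charF).
by move/(dvdn_leq _); case: (posnP (j - i)) => [|j_i /(_ isT)]; lia.
Qed.

(** The p elements of the prime field are already all the roots that 'X^p - 'X
    can have. *)
Lemma prime_fieldP (c : F) : c ^+ p = c -> exists m : nat, c = m%:R.
Proof.
move=> cp; pose rs := [seq i%:R : F | i <- iota 0 p].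
have [/mapP[m _ ->]|nc] := boolP (c \in rs); first by exists m.
have p1 := prime_gt1 prime_p.
have sP : size ('X^p - 'X : {poly F}) = p.+1.
  by rewrite size_polyDl size_polyXn // size_polyN size_polyX.
have P0 : 'X^p - 'X != 0 :> {poly F} by rewrite -size_poly_gt0 sP.
have := @max_poly_roots _ _ (c :: rs) P0.
rewrite sP /= size_map size_iota ltnn nc => h; suff: false by [].
apply: h.
  apply/andP; split; first by rewrite rootE !hornerE /= cp subrr.
  apply/allP => _ /mapP[m _ ->].
  by rewrite rootE !hornerE /= natr_pow_p subrr.
rewrite map_inj_in_uniq ?iota_uniq // => i j.
by rewrite !mem_iota => /andP[_ ip] /andP[_ jp]; apply: natr_eq_mod.
Qed.

(** The telescoping sum of (i + 1) ^ (e + 1) - i ^ (e + 1) vanishes and, once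
    the lower power sums do, leaves (e + 1) times the e-th power sum. *)
Lemma power_sum_lt (e : nat) : (e < p.-1)%N ->
  \sum_(0 <= i < p) (i%:R : F) ^+ e = 0.
Proof.
have p0 := prime_gt0 prime_p.
elim/ltn_ind: e => e IH ep.
have := @telescope_sumr F 0 p (fun i => i%:R ^+ e.+1) (leq0n p).
rewrite /= pcharf0 // !expr0n /= subr0.
under eq_bigr => i _ do
  rewrite -[i.+1]addn1 natrD exprD1n big_ord_recr /= binn mulr1n addrK.
rewrite exchange_big /= big_ord_recr /= big1 => [|i _]; last first.
  by rewrite sumrMnl IH ?mul0rn //; have := ltn_ord i; lia.
rewrite add0r sumrMnl binSn -[_ *+ e.+1]mulr_natr => /eqP; rewrite mulf_eq0.
case/orP => [/eqP//|]; rewrite -(dvdn_pcharf charF) => /dvdn_leq; lia.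
Qed.

Lemma power_sum_top : \sum_(0 <= i < p) (i%:R : F) ^+ p.-1 = -1.
Proof.
have p1 := prime_gt1 prime_p.
rewrite big_ltn ?prime_gt0 // expr0n; case: eqP => [|_]; first by lia.
rewrite add0r (eq_big_nat _ _ (F2 := fun => 1)) => [|i /andP[i0 ip]].
  rewrite sumr_const_nat -[1 *+ _]/(_%:R).
  by apply/eqP; rewrite -subr_eq0 opprK natr1 subn1 prednK ?pcharf0 // ltnW.
have i0F : (i%:R : F) != 0.
  by apply: contraTneq i0 => /(natr_eq_mod ip (ltnW p1)) ->.
by apply: (mulfI i0F); rewrite -exprS mulr1 prednK ?natr_pow_p // prime_gt0.
Qed.

Lemma translate_sum (y c : F) (a : nat) :
  c != 0 -> c ^+ p = c -> (a <= p.-1)%N ->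
  \sum_(0 <= i < p) (y + i%:R * c) ^+ a = if a == p.-1 then -1 else 0.
Proof.
move=> c0 cp ap; under eq_bigr => i _ do rewrite exprDn.
rewrite exchange_big /= big_ord_recr /= big1 => [|b _]; last first.
  rewrite sumrMnl; under eq_bigr => i _ do rewrite exprMn mulrCA.
  by rewrite -mulr_suml power_sum_lt ?mul0r ?mul0rn // (leq_trans _ ap).
rewrite add0r binn sumrMnl mulr1n subnn.
under eq_bigr => i _ do rewrite expr0 mul1r exprMn.
rewrite -mulr_suml; case: eqP => [->|ne].
  rewrite power_sum_top mulN1r; congr (- _); apply: (mulfI c0).
  by rewrite -exprS mulr1 prednK // prime_gt0.
by rewrite power_sum_lt ?mul0r // ltn_neqAle ap andbT; apply/eqP.
Qed.

End PowerSums.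

Section TowerTrace.
Variables (K : fieldType) (F : splittingFieldType K) (p : nat).
Hypothesis charF : p \in [pchar F].
Implicit Types (x : gal_of {:F}) (U : {subfield F}) (y : F).

Let prime_p : prime p := pcharf_prime charF.

Lemma galMf x1 x2 (a : F) : (x1 * x2)%g a = x2 (x1 a).
Proof. by rewrite galM ?memvf. Qed.

Section Step.
Variables (x : gal_of {:F}) (U : {subfield F}) (y : F).
Hypothesis fixU : forall a, a \in U -> x a = a.
Hypothesis yU : y ^+ p - y \in U.

Lemma artin_schreier_conj :
  exists m : nat, forall i, (x ^+ i)%g y = y + i%:R * m%:R.
Proof.
have [m em] : exists m : nat, x y - y = m%:R.
  apply: (prime_fieldP charF).
  have -> : (x y - y) ^+ p = x y ^+ p - y ^+ p.
    exact: (rmorphB (pFrobenius_aut charF)).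
  have := fixU yU; rewrite rmorphB rmorphXn /= => e.
  rewrite -[x y ^+ p](subrK (x y)) e addrAC [y ^+ p - y]addrC addrK.
  by rewrite addrC.
exists m; elim=> [|i IH]; first by rewrite expg0 gal_id mul0r addr0.
rewrite expgSr galMf IH rmorphD rmorphM !rmorph_nat -natr1 mulrDl mul1r.
by rewrite -em addrCA addrC; congr (_ + _); rewrite addrC subrK.
Qed.

Lemma fixes_adjoin (z : gal_of {:F}) : (forall a, a \in U -> z a = a) ->
  z y = y -> forall a, a \in <<U; y>>%VS -> z a = a.
Proof.
move=> zU zy a /Fadjoin_polyP[q qU ->].
rewrite -horner_map /= zy; congr (_.[_]); apply/polyP => i.
by rewrite coef_map /= zU // (polyOverP qU).
Qed.

Lemma expg_fixes i a : a \in U -> (x ^+ i)%g a = a.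
Proof.
move=> aU; elim: i => [|i IH]; first by rewrite expg0 gal_id.
by rewrite expgSr galMf IH fixU.
Qed.

Lemma expgp_fixes_adjoin a : a \in <<U; y>>%VS -> (x ^+ p)%g a = a.
Proof.
apply: fixes_adjoin; first exact: expg_fixes.
by have [m ->] := artin_schreier_conj; rewrite pcharf0 // mul0r addr0.
Qed.

(** Trace of a power of an Artin-Schreier generator: the conjugates of y are
    its translates by the prime field. *)
Lemma artin_schreier_trace (b : F) (a : nat) : x y != y -> b \in U ->
  (a <= p.-1)%N ->
  \sum_(0 <= i < p) (x ^+ i)%g (b * y ^+ a) = if a == p.-1 then - b else 0.
Proof.
move=> xy bU ap; have [m em] := artin_schreier_conj.
have m0 : m%:R != 0 :> F.
  apply: contraNneq xy => e.
  by rewrite -[x]expg1 em e mulr0 addr0.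
under eq_bigr => i _ do rewrite rmorphM rmorphXn /= expg_fixes // em.
rewrite -mulr_sumr (translate_sum charF) //; last exact: natr_pow_p.
by case: eqP; rewrite ?mulr0 ?mulrN1.
Qed.

End Step.

Variables (n : nat) (L : nat -> {subfield F}) (y : nat -> F).
Variable (x : gal_of {:F}).
Hypothesis ox : #[x]%g = (p ^ n)%N.
Hypothesis L0 : L 0 = 1%AS.
Hypothesis Ln : L n = {:F}%AS.
Hypothesis Ly : forall j, (j < n)%N -> <<L j; y j.+1>>%VS = L j.+1.
Hypothesis yL : forall j, (j < n)%N -> y j.+1 ^+ p - y j.+1 \in L j.

Lemma tower_fixed j a : (j <= n)%N -> a \in L j -> (x ^+ (p ^ j))%g a = a.
Proof.
elim: j a => [|j IH] a jn; last first.
  rewrite -Ly // expnSr expgM; apply: expgp_fixes_adjoin; last exact: yL.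
  by move=> b; apply: IH; apply: ltnW.
rewrite L0 expn0 expg1 => /vlineP[c ->].
by rewrite linearZ /= rmorph1.
Qed.

(** If x ^ (p ^ j) fixed y j.+1, then by the same argument at the later steps
    x ^ (p ^ n.-1) would be trivial, against the order of x. *)
Lemma tower_moved j : (j < n)%N -> (x ^+ (p ^ j))%g (y j.+1) != y j.+1.
Proof.
move=> jn; apply/negP => /eqP e.
have fix_up l : (j < l <= n)%N ->
    forall a, a \in L l -> (x ^+ (p ^ l.-1))%g a = a.
  elim: l => // l IH /andP[jl ln] /= a; move: jl.
  rewrite ltnS leq_eqVlt => /orP[/eqP<-|jl].
    rewrite -Ly //; apply: fixes_adjoin => // b; apply: tower_fixed.
    exact: ltnW.
  have l0 : (0 < l)%N by apply: leq_trans jl.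
  rewrite -Ly //; have -> : (p ^ l = p ^ l.-1 * p)%N by rewrite -expnSr prednK.
  rewrite expgM.
  apply: expgp_fixes_adjoin; last exact: yL.
  by apply: IH; rewrite jl ltnW.
have : (x ^+ (p ^ n.-1))%g == 1%g.
  apply/gal_eqP => a aF; rewrite gal_id.
  by apply: fix_up; rewrite ?jn ?leqnn // Ln memvf.
rewrite -order_dvdn ox => /(dvdn_leq _).
rewrite expn_gt0 prime_gt0 // => /(_ isT).
by rewrite leqNgt ltn_exp2l ?prime_gt1 // ltn_predL (leq_ltn_trans _ jn).
Qed.

(** The trace from L j to L 0: the powers of the generator x below p ^ j
    represent the Galois group of that step. *)
Definition tower_trace j (z : F) : F := \sum_(0 <= i < p ^ j) (x ^+ i)%g z.

Lemma sum_nat_mul (V : nmodType) (m q : nat) (f : nat -> V) :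
  \sum_(0 <= i < q * m) f i =
  \sum_(0 <= i < m) \sum_(0 <= l < q) f (l * m + i)%N.
Proof.
rewrite exchange_big /=; elim: q => [|q IH]; first by rewrite mul0n !big_geq.
rewrite big_nat_recr //= -IH mulSn addnC.
rewrite (@big_cat_nat _ _ _ (q * m)) ?leq_addr //=.
congr (_ + _); rewrite -{1}[(q * m)%N]add0n big_addn addnC addnK.
by apply: eq_bigr => i _; rewrite addnC.
Qed.

Lemma tower_traceS j z :
  tower_trace j.+1 z =
  tower_trace j (\sum_(0 <= i < p) ((x ^+ (p ^ j)) ^+ i)%g z).
Proof.
rewrite /tower_trace expnS sum_nat_mul; apply: eq_bigr => i _.
rewrite rmorph_sum /=; apply: eq_bigr => l _.
by rewrite expgD galMf mulnC expgM.
Qed.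

Definition monomial (d : nat -> nat) j : F := \prod_(l < j) y l.+1 ^+ d l.

Lemma monomialS d j : monomial d j.+1 = monomial d j * y j.+1 ^+ d j.
Proof. by rewrite /monomial big_ord_recr. Qed.

Lemma tower_le i j : (i <= j <= n)%N -> (L i <= L j)%VS.
Proof.
case/andP; elim: j => [|j IH]; first by rewrite leqn0 => /eqP->.
rewrite leq_eqVlt => /orP[/eqP->//|ij jn].
by apply: subv_trans (IH ij (ltnW jn)) _; rewrite -Ly // subv_adjoin.
Qed.

Lemma monomial_mem d j : (j <= n)%N -> monomial d j \in L j.
Proof.
move=> jn; apply: rpred_prod => -[l lj] _ /=; apply: rpredX.
apply: (subvP (tower_le (i := l.+1) _)); first by rewrite lj.
by rewrite -Ly ?memv_adjoin // (leq_trans lj).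
Qed.

Lemma tower_trace_monomialS d j : (j < n)%N -> (d j <= p.-1)%N ->
  tower_trace j.+1 (monomial d j.+1) =
  if d j == p.-1 then - tower_trace j (monomial d j) else 0.
Proof.
move=> jn dj; rewrite tower_traceS monomialS.
rewrite (@artin_schreier_trace _ (L j)) ?tower_moved ?yL //.
- case: eqP => _; rewrite /tower_trace.
    by rewrite -sumrN; apply: eq_bigr => i _; rewrite rmorphN.
  by rewrite big1 // => i _; rewrite rmorph0.
- by move=> a; apply: tower_fixed; apply: ltnW.
by apply: monomial_mem; apply: ltnW.
Qed.

Lemma tower_trace_top d j : (j <= n)%N -> (forall l, (l < j)%N -> d l = p.-1) ->
  tower_trace j (monomial d j) = (-1) ^+ j.
Proof.
elim: j => [|j IH] jn hd.
  by rewrite /tower_trace /monomial big_ord0 big_nat1 rmorph1.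
rewrite tower_trace_monomialS ?hd // eqxx IH ?exprS ?mulN1r ?(ltnW jn) //.
by move=> l lj; apply: hd; apply: ltnW.
Qed.

Lemma tower_trace_lower d i j : (i < j <= n)%N -> (d i < p.-1)%N ->
  (forall l, (i < l < j)%N -> d l = p.-1) -> tower_trace j (monomial d j) = 0.
Proof.
case/andP; elim: j => // j IH; rewrite ltnS leq_eqVlt => ij jn di hd.
case/orP: ij => [/eqP ij|ij].
  have dj : (d j < p.-1)%N by rewrite -ij.
  by rewrite tower_trace_monomialS ?(ltnW dj) // (ltn_eqF dj).
rewrite tower_trace_monomialS ?hd ?ij ?ltnSn // eqxx IH ?oppr0 ?(ltnW jn) //.
by move=> l /andP[il lj]; rewrite hd // il ltnW.
Qed.

End TowerTrace.

Section CyclicTrace.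
Variables (K : fieldType) (F : splittingFieldType K).

Lemma galTrace_cycle (x : gal_of {:F}) (z : F) : ('Gal({:F} / 1) = <[x]>)%g ->
  galTrace 1%AS {:F}%AS z = \sum_(0 <= i < #[x]%g) (x ^+ i)%g z.
Proof.
move=> e; rewrite /galTrace e big_mkord.
have -> : <[x]>%g = [set (x ^+ i)%g | i : 'I_#[x]%g].
  apply/setP => u; apply/cycleP/imsetP => [[m ->]|[i _ ->]]; last by exists i.
  exists (Ordinal (ltn_pmod m (order_gt0 x))) => //=.
  by rewrite expg_mod_order.
rewrite big_imset //= => i l _ _ /eqP; rewrite eq_expg_mod_order.
by rewrite !modn_small // => /eqP /val_inj.
Qed.

End CyclicTrace.

(** * Digits and pole orders *)

Section Digits.
Local Open Scope nat_scope.
Variables (p n : nat).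
Hypothesis p_gt1 : (1 < p)%N.
Local Notation N := (p ^ n)%N.
Implicit Types (m j : nat) (lam : nat -> nat).

Let p_gt0 : (0 < p)%N := ltnW p_gt1.

Lemma expn_pgt0 j : (0 < p ^ j)%N.
Proof. by rewrite expn_gt0 p_gt0. Qed.

Lemma digit_le m j : (digit p m j <= p.-1)%N.
Proof. by rewrite -ltnS prednK // ltn_mod. Qed.

(** The least j for which both quotients by p ^ j agree gives the leading digit
    in which the numbers differ. *)
Lemma digit_lex m1 m2 : (m1 < m2)%N -> (m2 < N)%N ->
  exists2 j, (0 < j <= n)%N & (digit p m1 j < digit p m2 j)%N /\
    forall l, (j < l <= n)%N -> digit p m1 l = digit p m2 l.
Proof.
move=> m12 m2N.
pose A j := (m1 %/ p ^ j == m2 %/ p ^ j)%N.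
have An : A n by rewrite /A !divn_small // (ltn_trans m12).
have exA : exists j, A j by exists n.
case: (ex_minnP exA) => j Aj jmin.
have j0 : (0 < j)%N.
  case: j Aj {jmin} => //; rewrite /A expn0 !divn1 => /eqP e.
  by rewrite e ltnn in m12.
have up l : (j <= l)%N -> (m1 %/ p ^ l = m2 %/ p ^ l)%N.
  by move=> jl; rewrite -(subnKC jl) expnD !divnMA (eqP Aj).
exists j; first by rewrite j0 jmin.
split=> [|l /andP[jl _]]; last by rewrite /digit up // -ltnS (ltn_predK jl).
have lt : (m1 %/ p ^ j.-1 < m2 %/ p ^ j.-1)%N.
  rewrite ltn_neqAle leq_div2r ?(ltnW m12) // andbT.
  by apply/negP => /jmin; rewrite leqNgt ltn_predL j0.
rewrite /digit; move: lt.
rewrite [X in (X < _)%N](divn_eq _ p) [X in (_ < X)%N](divn_eq _ p).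
by rewrite -!divnMA -expnSr prednK // (eqP Aj) ltn_add2l.
Qed.

Lemma divn_compl (M d m : nat) : (0 < d)%N -> (m < M * d)%N ->
  ((M * d).-1 - m) %/ d = (M.-1 - m %/ d)%N.
Proof.
move=> d0 mMd; have qM : (m %/ d < M)%N by rewrite ltn_divLR.
have rd := ltn_pmod m d0.
suff -> : ((M * d).-1 - m = (M.-1 - m %/ d) * d + (d.-1 - m %% d))%N.
  rewrite divnMDl // [(d.-1 - _) %/ d]divn_small ?addn0 //.
  by rewrite (leq_ltn_trans (leq_subr _ _)) // ltn_predL.
rewrite {1}(divn_eq m d) mulnBl.
have -> : (M * d = M.-1 * d + d)%N by rewrite -{1}(ltn_predK qM) mulSn addnC.
have : (m %/ d * d <= M.-1 * d)%N.
  by rewrite leq_mul2r -ltnS (ltn_predK qM) qM orbT.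
by move: (m %/ d * d)%N (M.-1 * d)%N (m %% d)%N rd => a b c; clear -d0; lia.
Qed.

Lemma digit_compl m j : (m < N)%N -> (0 < j <= n)%N ->
  digit p (N.-1 - m) j = (p.-1 - digit p m j)%N.
Proof.
move=> mN /andP[j0 jn]; rewrite /digit.
have eN : (p ^ (n - j.-1) * p ^ j.-1 = N)%N by rewrite -expnD subnK //; lia.
rewrite -eN divn_compl ?expn_pgt0 ?eN //.
have : (m %/ p ^ j.-1 < p ^ (n - j) * p)%N.
  rewrite -expnSr ltn_divLR ?expn_pgt0 // -expnD.
  by have -> : ((n - j).+1 + j.-1 = n)%N by lia.
have -> : (p ^ (n - j.-1) = p ^ (n - j) * p)%N.
  by rewrite -expnSr; congr expn; lia.
move: (m %/ p ^ j.-1)%N (p ^ (n - j))%N => q M qM.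
have Q0 : (q %/ p < M)%N by rewrite ltn_divLR.
have rp := ltn_pmod q p_gt0.
suff -> : ((M * p).-1 - q = (M.-1 - q %/ p) * p + (p.-1 - q %% p))%N.
  rewrite modnMDl [(p.-1 - _) %% p]modn_small //.
  by rewrite (leq_ltn_trans (leq_subr _ _)) // ltn_predL.
rewrite {1}(divn_eq q p) mulnBl.
have -> : (M * p = M.-1 * p + p)%N by rewrite -{1}(ltn_predK Q0) mulSn addnC.
have : (q %/ p * p <= M.-1 * p)%N.
  by rewrite leq_mul2r -ltnS (ltn_predK Q0) Q0 orbT.
by move: (q %/ p * p)%N (M.-1 * p)%N (q %% p)%N rp => a b c; clear -p_gt0; lia.
Qed.

(** Pole order at a totally ramified place of the basis monomial of index m. *)
Definition pole_order lam m : nat :=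
  \sum_(1 <= j < n.+1) digit p m j * lam j * p ^ (n - j).

Lemma pole_order_compl lam m : (m < N)%N ->
  (pole_order lam (N.-1 - m) + pole_order lam m = pole_order lam N.-1)%N.
Proof.
move=> mN; rewrite /pole_order -big_split /=; apply: eq_big_nat => j jn.
have jn' : (0 < j <= n)%N by [].
rewrite digit_compl // -(subn0 N.-1) digit_compl // ?expn_pgt0 //.
rewrite /digit div0n mod0n subn0 -!mulnDl subnK //; exact: digit_le.
Qed.

(** At the leading digit of difference j, both pole orders agree modulo
    p ^ (n - j) but not modulo p ^ (n - j + 1), as lam j is prime to p. *)
Lemma pole_order_inj lam m1 m2 :
  (forall j, (0 < j <= n)%N -> coprime (lam j) p) ->
  (m1 < N)%N -> (m2 < N)%N ->
  pole_order lam m1 = pole_order lam m2 %[mod N] -> m1 = m2.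
Proof.
move=> cop; wlog m12 : m1 m2 / (m1 < m2)%N.
  move=> h m1N m2N e; case: (ltngtP m1 m2) => // lt; first exact: h.
  by apply/esym; apply: h.
move=> _ m2N /eqP e; have [j /andP[j0 jn] [jlt jeq]] := digit_lex m12 m2N.
have split_sum m : pole_order lam m =
    (\sum_(1 <= l < j) digit p m l * lam l * p ^ (n - l) +
     (digit p m j * lam j * p ^ (n - j) +
      \sum_(j.+1 <= l < n.+1) digit p m l * lam l * p ^ (n - l)))%N.
  rewrite /pole_order (@big_cat_nat _ _ _ j) //= ?(ltnW jn) //.
    by congr addn; rewrite big_ltn.
  exact: leqW.
have low m : (p ^ (n - j).+1 %|
    \sum_(1 <= l < j) digit p m l * lam l * p ^ (n - l))%N.
  rewrite big_nat; apply: dvdn_sum => l /andP[l1 lj].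
  by rewrite dvdn_mull // dvdn_exp2l //; lia.
have e' : pole_order lam m1 == pole_order lam m2 %[mod p ^ (n - j).+1].
  have dN : (p ^ (n - j).+1 %| N)%N by rewrite dvdn_exp2l //; lia.
  by rewrite -(modn_dvdm _ dN) (eqP e) modn_dvdm.
move: e'; rewrite !split_sum.
have -> : (\sum_(j.+1 <= l < n.+1) digit p m1 l * lam l * p ^ (n - l) =
  \sum_(j.+1 <= l < n.+1) digit p m2 l * lam l * p ^ (n - l))%N.
  by apply: eq_big_nat => l /andP[jl ln]; rewrite jeq // jl.
move: (\sum_(j.+1 <= l < n.+1) _)%N => t.
rewrite -modnDml (eqP (low m1)) add0n.
rewrite -[X in _ == X]modnDml (eqP (low m2)) add0n.
rewrite eqn_modDr eq_sym eqn_mod_dvd; last first.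
  by rewrite !leq_mul2r (ltnW jlt) !orbT.
rewrite -!mulnBl expnS dvdn_pmul2r ?expn_pgt0 //.
rewrite mulnC Gauss_dvdr; last by rewrite coprime_sym cop // j0.
move=> /(dvdn_leq _); rewrite subn_gt0 jlt => /(_ isT).
by have := digit_le m2 j; clear -p_gt1 jlt; lia.
Qed.

Lemma pole_order_surj lam a :
  (forall j, (0 < j <= n)%N -> coprime (lam j) p) ->
  exists2 m, (m < N)%N & pole_order lam m = a %[mod N].
Proof.
move=> cop; have N0 : (0 < N)%N by apply: expn_pgt0.
pose f (m : 'I_N) : 'I_N := Ordinal (ltn_pmod (pole_order lam m) N0).
have f_inj : injective f.
  move=> m1 m2 /(congr1 val) /= e; apply: val_inj.
  exact: (pole_order_inj cop (ltn_ord m1) (ltn_ord m2) e).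
pose b : 'I_N := Ordinal (ltn_pmod a N0).
have /codomP[m em] : b \in codom f.
  by apply: inj_card_onto f_inj _ b; rewrite card_ord.
by exists m => //; have := congr1 val em => /= <-.
Qed.

End Digits.

(** * Places in finite extensions *)

Section Restriction.
Variables (k : closedFieldType) (E F : fieldExtType (ratfun k)).
Variables (iota : {rmorphism E -> F}) (Q : place F).
Hypothesis iota_const : forall c, iota (const E c) = const F c.

Let i0 (f : E) : f != 0 -> iota f != 0.
Proof. by rewrite fmorph_eq0. Qed.

Lemma restrict_val_dvd : (exists2 f, f != 0 & Q (iota f) != 0) ->
  exists e : nat, [/\ (0 < e)%N, exists f, Q (iota f) = e%:Z
    & forall f, exists z, Q (iota f) = e%:Z * z].
Proof.
case=> f f0 Qf.
pose A d := `[< (0 < d)%N /\ exists2 h : E, h != 0 & Q (iota h) = d%:Z >].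
have exA : exists d, A d.
  exists `|Q (iota f)|%N; apply/asboolP; split; first by rewrite absz_gt0.
  have [le|lt] := ger0P (Q (iota f)); first by exists f => //; rewrite gez0_abs.
  exists f^-1; first by rewrite invr_eq0.
  by rewrite fmorphV place_valV ltz0_abs.
case: (ex_minnP exA) => e /asboolP[e0 [t t0 Qt]] emin.
exists e; split=> //; first by exists t.
move=> h; have [->|h0] := eqVneq h 0.
  by exists 0; rewrite rmorph0 val_at0 mulr0.
pose z := (Q (iota h) %/ e%:Z)%Z; pose r := (Q (iota h) %% e%:Z)%Z.
exists z; have Qh : Q (iota h) = z * e%:Z + r by apply: divz_eq.
have r0 : 0 <= r by rewrite modz_ge0 // -lt0n.
have re : r < e%:Z by rewrite ltz_pmod.
pose g := h / t ^ z.
have tz0 : t ^ z != 0 by rewrite expfz_neq0.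
have g0 : g != 0 by rewrite mulf_neq0 ?invr_eq0.
have Qg : Q (iota g) = r.
  rewrite /g fmorph_div fmorphXz.
  rewrite (place_val_div Q (i0 h0) _).2 ?expfz_neq0 ?i0 //.
  by rewrite place_valXz Qt Qh addrC addKr.
have [r00|r00] := eqVneq r 0; first by rewrite Qh r00 addr0 mulrC.
have : A `|r|%N.
  apply/asboolP; rewrite absz_gt0 r00; split=> //.
  by exists g; rewrite ?gez0_abs.
by move=> /emin; clear -r0 re; lia.
Qed.

(** The orders of the elements of E form a nonzero group of integers; dividing
    by its generator e normalizes the restriction of Q. *)
Lemma restrict_place : (exists2 f, f != 0 & Q (iota f) != 0) ->
  exists (V : place E) (e : nat), (0 < e)%N /\
    forall f, Q (iota f) = e%:Z * V f.
Proof.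
move=> /restrict_val_dvd[e [e0 [t Qt] /choice[V hV]]].
have eP : (0 : int) < e%:Z by rewrite ltz_nat.
have eN : (e%:Z : int) != 0 by rewrite gt_eqF.
have V0 : V 0 = 0.
  by apply: (mulfI eN); rewrite -hV rmorph0 val_at0 mulr0.
have VM f g : f != 0 -> g != 0 -> V (f * g) = V f + V g.
  move=> f0 g0; apply: (mulfI eN).
  by rewrite mulrDr -!hV rmorphM val_atM ?i0.
have VD f g : f != 0 -> g != 0 -> f + g != 0 ->
    Num.min (V f) (V g) <= V (f + g).
  move=> f0 g0 s0; have := val_atD Q (i0 f0) (i0 g0).
  rewrite -rmorphD => /(_ (i0 s0)).
  by rewrite /= !hV !ge_min !ler_pM2l.
have Vc c : c != 0 -> V (const E c) = 0.
  move=> c0; apply: (mulfI eN).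
  by rewrite -hV iota_const mulr0 val_at_const.
have V1 : exists t, V t = 1.
  by exists t; apply: (mulfI eN); rewrite -hV Qt mulr1.
by exists (Place V0 VM VD Vc V1), e.
Qed.

End Restriction.

Section Transport.
Variables (k : closedFieldType) (E M : fieldExtType (ratfun k)).
Variable phi : {rmorphism E -> M}.
Hypothesis phi_const : forall c, phi (const E c) = const M c.
Hypothesis phi_onto : forall f, exists x, phi x = f.

Lemma transport_place (Q : place E) : constant_residues Q ->
  exists V : place M, (forall x, V (phi x) = Q x) /\ constant_residues V.
Proof.
move=> res; have /choice[psi psiK] := phi_onto.
pose V f := Q (psi f).
have VE x : V (phi x) = Q x.
  by rewrite /V; congr (Q _); apply: (fmorph_inj phi); rewrite psiK.
have V0 : V 0 = 0 by rewrite -(rmorph0 phi) VE val_at0.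
have VM f g : f != 0 -> g != 0 -> V (f * g) = V f + V g.
  rewrite -(psiK f) -(psiK g) !fmorph_eq0 -rmorphM !VE => f0 g0.
  exact: val_atM.
have VD f g : f != 0 -> g != 0 -> f + g != 0 ->
    Num.min (V f) (V g) <= V (f + g).
  rewrite -(psiK f) -(psiK g) -rmorphD !fmorph_eq0 !VE.
  exact: val_atD.
have Vc c : c != 0 -> V (const M c) = 0.
  by move=> c0; rewrite -phi_const VE val_at_const.
have V1 : exists t, V t = 1.
  by have [t Qt] := val_at_onto Q; exists (phi t); rewrite VE.
exists (Place V0 VM VD Vc V1); split=> // f hf.
have [c hc] : exists c, pge Q 1 (psi f - const E c).
  by apply: res; move: hf; rewrite /pge /= -{1}(psiK f) fmorph_eq0.
exists c; rewrite -{1}(psiK f) -phi_const -rmorphB.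
by rewrite /pge fmorph_eq0 /= VE.
Qed.

End Transport.

Section Conjugation.
Variables (k : closedFieldType) (F : splittingFieldType (ratfun k)).
Variables (x : gal_of {:F}) (Q : place F).

Let conj0 : Q (x 0) = 0.
Proof. by rewrite rmorph0 val_at0. Qed.

Let conjM f g : f != 0 -> g != 0 -> Q (x (f * g)) = Q (x f) + Q (x g).
Proof. by move=> f0 g0; rewrite rmorphM val_atM ?fmorph_eq0. Qed.

Let conjD f g : f != 0 -> g != 0 -> f + g != 0 ->
  Num.min (Q (x f)) (Q (x g)) <= Q (x (f + g)).
Proof.
move=> f0 g0 s0; rewrite rmorphD; apply: val_atD; rewrite ?fmorph_eq0 //.
by rewrite -rmorphD fmorph_eq0.
Qed.

Lemma gal_alg (c : ratfun k) : x (c%:A) = c%:A.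
Proof. by rewrite linearZ /= rmorph1. Qed.

Let conj_const c : c != 0 -> Q (x (const F c)) = 0.
Proof. by move=> c0; rewrite gal_alg val_at_const. Qed.

Let conj_onto : exists t, Q (x t) = 1.
Proof.
have [t Qt] := val_at_onto Q; exists ((x^-1)%g t).
by rewrite -galM ?memvf // mulVg gal_id.
Qed.

Definition conj_place : place F :=
  Place conj0 conjM conjD conj_const conj_onto.

End Conjugation.

Section RamifiedBasis.
Variables (k : closedFieldType) (E : fieldExtType (ratfun k)) (N : nat).
Variables (Q : place E) (P0 : place (ratfun k)^o).
Hypothesis ramQ : forall f, Q f%:A = N%:Z * P0 f.
Hypothesis dimE : \dim {:E} = N.

Lemma ram_valZ (c : ratfun k) (b : E) : c != 0 -> b != 0 ->
  Q (c *: b) = N%:Z * P0 c + Q b.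
Proof.
move=> c0 b0; rewrite -mulr_algl val_atM ?ramQ //.
by rewrite scaler_eq0 negb_or c0 oner_eq0.
Qed.

Section Basis.
Variable b : 'I_N -> E.
Hypothesis b0 : forall i, b i != 0.
Hypothesis b_distinct :
  forall i j (z : int), Q (b i) = Q (b j) + N%:Z * z -> i = j.

Lemma ram_basis_min (c : 'I_N -> ratfun k) M :
  pge Q M (\sum_i c i *: b i) -> forall i, pge Q M (c i *: b i).
Proof.
apply: pge_sum_distinct => i j; rewrite !scaler_eq0 !negb_or.
move=> /andP[ci _] /andP[cj _].
rewrite (ram_valZ ci (b0 i)) (ram_valZ cj (b0 j)) => e.
apply: (b_distinct (z := P0 (c j) - P0 (c i))).
by rewrite mulrBr; clear -e; lia.
Qed.

(** Orders that are pairwise distinct modulo the ramification index make the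
    elements independent, and there are enough of them to span. *)
Lemma ram_basis_span (f : E) :
  exists c : 'I_N -> ratfun k, f = \sum_i c i *: b i.
Proof.
pose X := [tuple b i | i < N].
have XE (i : 'I_N) : X`_i = b i by rewrite -tnth_nth tnth_mktuple.
have freeX : free X.
  apply/freeP => c e i; apply/eqP; apply: contraT => ci.
  have h : pge Q (Q (c i *: b i) + 1) (c i *: b i).
    apply: ram_basis_min; move: e; under eq_bigr do rewrite XE.
    by move=> ->; apply: pge0.
  move: h; rewrite pgeE; last by rewrite scaler_eq0 negb_or ci b0.
  by rewrite gerDl ler10.
have basX : basis_of {:E} X.
  by rewrite basisEfree freeX subvf size_tuple dimE leqnn.
exists (fun i => coord X i f); rewrite {1}(coord_basis basX (memvf f)).
by apply: eq_bigr => i _; rewrite XE.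
Qed.

End Basis.

(** Expansion in powers of a uniformizer: total ramification leaves the residue
    field unchanged. *)
Lemma ram_residues : constant_residues P0 -> constant_residues Q.
Proof.
move=> res f hf; have [t Qt] := val_at_onto Q.
have t0 : t != 0 by apply: contraTneq isT => e; move: Qt; rewrite e val_at0.
pose b (i : 'I_N) := t ^+ i.
have b0 i : b i != 0 by rewrite expf_neq0.
have Qb i : Q (b i) = i%:Z by rewrite place_valX Qt natz.
have bd i j (z : int) : Q (b i) = Q (b j) + N%:Z * z -> i = j.
  rewrite !Qb => e; apply: val_inj.
  have := congr1 (fun a => (a %% N%:Z)%Z) e.
  rewrite mulrC addrC modzMDl !modz_small ?ltz_nat ?ltn_ord //.
  by move=> [].
have N0 : (0 < N)%N by rewrite -dimE adim_gt0.
pose i0 := Ordinal N0.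
have [c fc] := ram_basis_span b0 bd f.
have hc : forall i, pge Q 0 (c i *: b i).
  by apply: (ram_basis_min b0 bd); rewrite -fc.
have [c0 h0] : exists c0, pge P0 1 ((c i0 : (ratfun k)^o) - const _ c0).
  apply: res; have := hc i0; have [->|ci] := eqVneq (c i0) 0.
    by move=> _; apply: pge0.
  rewrite !pgeE ?scaler_eq0 ?negb_or ?ci ?b0 // (ram_valZ ci (b0 _)) Qb addr0.
  by rewrite pmulr_rge0 // ltz_nat.
exists c0; rewrite fc (bigD1 i0) //= addrAC; apply: pgeD; last first.
  apply: pge_sum => i ni; have := hc i.
  have [->|ci] := eqVneq (c i) 0; first by rewrite scale0r !pge0.
  rewrite !pgeE ?scaler_eq0 ?negb_or ?ci ?b0 // (ram_valZ ci (b0 _)) Qb.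
  have i_gt0 : (0 < i)%N.
    by rewrite lt0n; apply: contraNneq ni => e; apply/eqP/val_inj.
  have := ltn_ord i; have [|le] := ltP (P0 (c i)) 0; last first.
    have : 0 <= N%:Z * P0 (c i) by rewrite mulr_ge0.
    by clear -i_gt0; lia.
  by clear -N0; nia.
have -> : c i0 *: b i0 - const E c0 = ((c i0 : (ratfun k)^o) - const _ c0)%:A.
  by rewrite /b expr0 constK scalerBl.
have [->|e0] := eqVneq ((c i0 : (ratfun k)^o) - const _ c0) 0.
  by rewrite scale0r pge0.
move: h0; rewrite !pgeE // ?scaler_eq0 ?negb_or ?e0 ?oner_eq0 // ramQ.
by clear -N0; nia.
Qed.

End RamifiedBasis.

Section Integrality.
Variables (k : closedFieldType) (F : splittingFieldType (ratfun k)) (N : nat).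
Variables (Q : place F) (P0 : place (ratfun k)^o).
Hypothesis N_gt0 : (0 < N)%N.
Hypothesis ramQ : forall f, Q f%:A = N%:Z * P0 f.

(** If f had a pole, the leading term of the monic equation would dominate. *)
Lemma integral_pge (f : F) : integral_over P0 f -> pge Q 0 f.
Proof.
case=> q [qm qint /rootP qf]; have [->|f0] := eqVneq f 0; first exact: pge0.
rewrite pgeE // leNgt; apply/negP => Qf.
set q' := map_poly _ q in qf.
have q'm : q' \is monic by rewrite map_monic.
have q'int i : pge Q 0 q'`_i.
  rewrite coef_map /= /pge ramQ; apply/orP; right.
  by rewrite mulr_ge0 ?qint.
have sq : (1 < size q')%N.
  rewrite ltnNge; apply/negP => /size1_polyC e; move: qf q'm.
  by rewrite e hornerC => ->; rewrite monicE lead_coef0 eq_sym oner_eq0.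
case es : (size q') sq => [|[|n]] // _.
have lead : q'`_n.+1 = 1 by move/eqP: q'm; rewrite lead_coefE es.
move: qf; rewrite horner_coef es big_ord_recr /= lead mul1r => qf.
have fn : f ^+ n.+1 = - \sum_(i < n.+1) q'`_i * f ^+ i.
  by apply/eqP; rewrite -addr_eq0 addrC qf.
have : pge Q (Q f *+ n.+1 + 1) (f ^+ n.+1).
  rewrite fn pgeN; apply: pge_sum => i _.
  have hi := pgexx Q (f ^+ i); rewrite place_valX in hi.
  apply: pgeW (pgeM (q'int i) hi).
  have le_in : (i <= n)%N by rewrite -ltnS.
  have e1 : n.+1 = (i + (n - i).+1)%N by rewrite addnS subnKC.
  have -> : Q f *+ n.+1 = Q f *+ i + Q f *+ (n - i).+1 by rewrite -mulrnDr -e1.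
  have : Q f *+ (n - i).+1 < 0 by rewrite pmulrn_llt0.
  by rewrite add0r -addrA gerDl lezD1.
rewrite pgeE ?expf_neq0 // place_valX; clear.
by rewrite gerDl ler10.
Qed.

(** The coefficients of the minimal polynomial are polynomials in the
    conjugates. *)
Lemma pge_integral (f : F) : galois 1%AS {:F}%AS ->
  (forall (x : gal_of {:F}), pge Q 0 (x f)) -> integral_over P0 f.
Proof.
move=> /(galois_factors (sub1v _)) /(_ f (memvf f))[r /= [_ _ er]] hf.
have := minPolyOver 1%AS f; move/polyOver1P => [q eq].
exists q; split.
- by rewrite -(map_monic (in_alg F)) -eq monic_minPoly.
- move=> i; have [->|qi0] := eqVneq q`_i 0; first by rewrite val_at0.
  have : pge Q 0 (minPoly 1%AS f)`_i.
    rewrite er big_map; elim: r {er} i {qi0} => [|x r IH] i.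
      rewrite big_nil coef1; exact: pge_nat.
    rewrite big_cons mulrBl coefB coefXM coefCM.
    apply: pgeB; last by apply: pgeM0.
    by case: eqP => _; [apply: pge0 | apply: IH].
  rewrite eq coef_map /= pgeE ?scaler_eq0 ?negb_or ?qi0 ?oner_eq0 // ramQ.
  by rewrite pmulr_rge0 // ltz_nat.
by rewrite -eq root_minPoly.
Qed.

End Integrality.

Section SubfieldInclusion.
Variables (K : fieldType) (F : fieldExtType K) (U V : {subfield F}).
Hypothesis UV : (U <= V)%VS.

Definition subvs_incl (a : subvs_of U) : subvs_of V :=
  Subvs (subvP UV _ (subvsP a)).

Lemma subvs_incl_zmod_morphism : zmod_morphism subvs_incl.
Proof. by move=> a b; apply: val_inj. Qed.

Lemma subvs_incl_monoid_morphism : monoid_morphism subvs_incl.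
Proof.
by split=> [|a b]; apply: val_inj => //=; rewrite !algid1.
Qed.

HB.instance Definition _ := GRing.isZmodMorphism.Build _ _ subvs_incl
  subvs_incl_zmod_morphism.
HB.instance Definition _ := GRing.isMonoidMorphism.Build _ _ subvs_incl
  subvs_incl_monoid_morphism.

Lemma map_poly_subvs_incl (q : {poly subvs_of U}) :
  map_poly vsval (map_poly subvs_incl q) = map_poly vsval q.
Proof. by rewrite -map_poly_comp; apply: eq_map_poly. Qed.

End SubfieldInclusion.

Section SubfieldConst.
Variables (k : closedFieldType) (F : fieldExtType (ratfun k)).
Variable U : {subfield F}.

Lemma vsval_alg (c : ratfun k) :
  vsval (c%:A : (subvs_of U : fieldExtType (ratfun k))) = c%:A.
Proof. by rewrite /= algid1. Qed.

Lemma vsval_const (c : k) : vsval (const (subvs_of U) c) = const F c.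
Proof. exact: vsval_alg. Qed.

End SubfieldConst.

Section ExtendPlace.
Variables (k : closedFieldType) (p : nat) (charp : p \in [pchar k]).
Variables (F : fieldExtType (ratfun k)) (U V : {subfield F}).
Variables (y : F) (B : subvs_of U) (Q : place (subvs_of U)).
Hypothesis yE : y ^+ p - y = vsval B.
Hypothesis Uy : <<U; y>>%VS = V.
Hypothesis dimV : \dim_U V = p.

Let UV : (U <= V)%VS.
Proof. by rewrite -Uy subv_adjoin. Qed.

Lemma minPoly_artin_schreier :
  minPoly U y = map_poly vsval ('X^p - 'X - B%:P : {poly subvs_of U}).
Proof.
set A : {poly subvs_of U} := _ - _.
have p1 := prime_gt1 (pcharf_prime charp).
have sA : size A = p.+1.
  rewrite /A -addrA size_polyDl size_polyXn //.
  rewrite -opprD size_polyN (leq_ltn_trans (size_polyD _ _)) // size_polyX.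
  by rewrite size_polyC; case: (B != 0) => /=; clear -p1; lia.
have mA : A \is monic.
  rewrite monicE lead_coefE sA /= /A !coefB coefXn eqxx coefX coefC.
  by rewrite !gtn_eqF ?subr0 // (ltn_trans _ p1).
have mAF : map_poly vsval A \is monic by rewrite map_monic.
have AF : map_poly vsval A = 'X^p - 'X - (vsval B)%:P.
  by rewrite /A !rmorphB /= map_polyXn map_polyX map_polyC.
have rA : root (map_poly vsval A) y by rewrite AF rootE !hornerE /= yE subrr.
have dvd : minPoly U y %| map_poly vsval A.
  by apply: minPoly_dvdp => //; apply/polyOver_subvs; exists A.
apply/eqP; rewrite -eqp_monic ?monic_minPoly // -dvdp_size_eqp //.
by rewrite size_minPoly size_map_poly sA adjoin_degreeE Uy dimV.
Qed.

Lemma extend_place : constant_residues Q -> pge Q 0 B ->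
  exists2 Q' : place (subvs_of V), constant_residues Q' &
    forall a b, vsval a = vsval b -> Q' b = Q a.
Proof.
move=> res hB.
have yV : y \in V by rewrite -Uy memv_adjoin.
pose y' : subvs_of V := Subvs yV.
have hornerV (q : {poly subvs_of U}) :
    vsval (map_poly (subvs_incl UV) q).[y'] = (map_poly vsval q).[y].
  by rewrite -(map_poly_subvs_incl UV) -[y]/(vsval y') horner_map.
have [||||Q' [Q'E Q'res]] := @artin_schreier_place k p (subvs_of U) (subvs_of V)
    (subvs_incl UV) Q B y' charp _ res hB.
- by move=> c; apply: val_inj; rewrite [LHS]vsval_const [RHS]vsval_const.
- apply: val_inj; rewrite [LHS](rmorphB (vsval : {rmorphism subvs_of V -> F})).
  by rewrite rmorphXn.
- move=> f; have fV : vsval f \in <<U; y>>%VS by rewrite Uy subvsP.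
  have [q0 /polyOver_subvs[q ->] fq] := Fadjoin_polyP fV.
  by exists q; apply: val_inj; rewrite [RHS]hornerV -fq.
- move=> q q0; rewrite -(dvdp_map (vsval : {rmorphism subvs_of U -> F})).
  rewrite -minPoly_artin_schreier minPoly_dvdp //.
    by apply/polyOver_subvs; exists q.
  by rewrite rootE -hornerV q0.
exists Q' => // a b ab; rewrite -Q'E; congr (Q' _).
by apply: val_inj; exact: (esym ab).
Qed.

End ExtendPlace.

(** * Cyclic towers over the rational function field *)

Section ArtinSchreierPole.
Variables (k : closedFieldType) (E : fieldExtType (ratfun k)) (Q : place E).

Lemma place_val_artin_schreier p (z : E) : (1 < p)%N -> Q z < 0 ->
  z ^+ p - z != 0 /\ Q (z ^+ p - z) = Q z *+ p.
Proof.
case: p => [|[|q]] // _ zneg.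
have z0 : z != 0 by apply: contraTneq zneg => ->; rewrite val_at0 ltxx.
rewrite -place_valX; apply: place_val_dom; first by rewrite expf_neq0.
rewrite pgeN pgeE // place_valX mulrS -addrA gerDl lezD1.
by rewrite pmulrn_llt0.
Qed.

End ArtinSchreierPole.

Lemma mul_ge_opp_pred (M u : nat) (v : int) : (0 < M)%N ->
  - (u + M.-1)%N%:Z <= M%:Z * v - u%:Z -> 0 <= v.
Proof.
move=> M0; rewrite leNgt => h; apply/negP => v0.
have : M%:Z * v <= M%:Z * -1 by rewrite ler_pM2l //; clear -v0; lia.
by move: h; clear -M0; lia.
Qed.

Lemma ceil_le (M u : nat) (v q r : int) : (0 < M)%N -> 0 <= r -> r < M%:Z ->
  (M.-1 + u)%N%:Z = q * M%:Z + r -> 0 <= M%:Z * v - u%:Z -> q <= v.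
Proof.
move=> M0 r0 rM e h; rewrite leNgt; apply/negP => vq.
have : M%:Z * (v + 1) <= M%:Z * q by rewrite ler_pM2l // lezD1.
by rewrite mulrDr mulr1 (mulrC _ q); move: r0 e h; clear -M0; lia.
Qed.

Section LinearFactors.
Variables (k : closedFieldType) (E : fieldExtType (ratfun k)) (Q : place E).
Local Notation lin a := (tofrac ('X - a%:P) : ratfun k).
Local Notation phi q := ((tofrac q)%:A : E).

Lemma lin_pole_eq (a b : k) : Q (lin a)%:A < 0 -> Q (lin b)%:A = Q (lin a)%:A.
Proof.
move=> neg.
have a0 : (lin a)%:A != 0 :> E.
  by rewrite scaler_eq0 negb_or oner_neq0 tofrac_eq0 polyXsubC_eq0.
have -> : (lin b)%:A = (lin a)%:A + const E (a - b).
  rewrite /const -scalerDl -tofracD; congr (tofrac _ *: _).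
  by rewrite polyCB addrA subrK.
case: (@place_val_dom _ _ Q _ (const E (a - b)) a0) => //.
by apply: pgeW (pge_const Q _); rewrite lezD1.
Qed.

Lemma polynomial_int (a : k) (q : {poly k}) : 0 < Q (lin a)%:A ->
  pge Q 0 (phi q).
Proof.
move=> pos; have Xint : pge Q 0 (phi 'X).
  have -> : phi 'X = (lin a)%:A + const E a.
    by rewrite /const -scalerDl -tofracD subrK.
  by apply: pgeD; [rewrite /pge ltW // orbT | apply: pge_const].
elim/poly_ind: q => [|q c IH]; first by rewrite tofrac0 scale0r pge0.
rewrite tofracD tofracM scalerDl; apply: pgeD; last exact: pge_const.
have -> : (tofrac q * tofrac 'X)%:A = phi q * phi 'X.
  by rewrite -scalerAl mul1r scalerA.
exact: pgeM0.
Qed.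

(** A polynomial not vanishing at a differs from a nonzero constant by a
    multiple of x - a, so only the multiplicity of the root a contributes to the
    order at Q. *)
Lemma lies_over_pos (a : k) : 0 < Q (lin a)%:A -> lies_over Q (finite_place a).
Proof.
move=> pos; pose e := `|Q (lin a)%:A|%N.
have eE : Q (lin a)%:A = e%:Z by rewrite /e gtz0_abs.
have phiM q r : phi (q * r) = phi q * phi r.
  by rewrite tofracM -scalerAl mul1r scalerA.
have phi0 q : q != 0 -> phi q != 0.
  by move=> q0; rewrite scaler_eq0 negb_or oner_neq0 tofrac_eq0 q0.
have Qunit q : ~~ root q a -> Q (phi q) = 0.
  move=> nr; have : root (q - q.[a]%:P) a by rewrite rootE !hornerE subrr.
  move=> /factor_theorem[h eh].
  have -> : phi q = const E q.[a] + phi h * (lin a)%:A.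
    by rewrite -phiM -eh /const -scalerDl -tofracD addrC subrK.
  have c0 : const E q.[a] != 0 by rewrite fmorph_eq0.
  have vc : Q (const E q.[a]) = 0 by rewrite val_at_const.
  case: (@place_val_dom _ _ Q _ (phi h * (lin a)%:A) c0) => [|_ ->] //.
  have := pgeM (polynomial_int h pos) (pgexx Q (lin a)%:A).
  by rewrite vc !add0r; apply: pgeW.
have Qpoly q : q != 0 -> Q (phi q) = e%:Z * (mup a q)%:Z.
  move=> q0; have [m [r]] := multiplicity_XsubC q a; rewrite q0 /= => nr eq.
  have r0 : r != 0 by apply: contraNneq q0 => er; rewrite eq er mul0r.
  have X0 : ('X - a%:P) ^+ m != 0 :> {poly k}.
    by rewrite expf_neq0 ?polyXsubC_eq0.
  rewrite {1}eq phiM val_atM ?phi0 // Qunit // add0r.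
  have -> : phi (('X - a%:P) ^+ m) = (lin a)%:A ^+ m.
    elim: m {X0 eq} => [|m IH]; first by rewrite !expr0 tofrac1 scale1r.
    by rewrite !exprS phiM IH.
  by rewrite place_valX eE eq mupMr // mup_XsubCX eqxx -mulr_natr natz.
exists e; split=> [|f]; first by rewrite -ltz_nat -eE.
have [->|f0] := eqVneq f 0; first by rewrite scale0r !val_at0 mulr0.
case: (ratfunP f0) => m [d [m0 d0 ->]].
have -> : (tofrac m / tofrac d)%:A = phi m / phi d.
  apply: (canRL (mulfK (phi0 d d0))).
  by rewrite -scalerAl mul1r scalerA divfK ?tofrac_eq0.
rewrite (place_val_div Q (phi0 _ m0) (phi0 _ d0)).2 !Qpoly //.
by rewrite /= finite_valE // mulrBr.
Qed.

End LinearFactors.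

Section CyclicTower.
Variables (k : closedFieldType) (p n s : nat).
Local Notation K := (ratfun k).
Variables (F : splittingFieldType K) (alpha : 'I_s -> k).
Variable L : nat -> {subfield F}.
Variables (y : forall j, subvs_of (L j)) (B : forall j, subvs_of (L j.-1)).
Variable Pl : 'I_s -> forall j, place (subvs_of (L j)).
Variables (lambda : 'I_s -> nat -> nat) (P : 'I_s -> place F).
Hypothesis charp : p \in [pchar k].
Hypothesis galF : galois 1%AS {:F}%AS.
Hypothesis cycF : cyclic 'Gal({:F} / 1).
Hypothesis degF : \dim {:F} = (p ^ n)%N.
Hypothesis alpha_inj : injective alpha.
Hypothesis ramE : forall Q : place K^o,
  ramified F Q <-> exists i, Q = finite_place (alpha i).
Hypothesis totram : forall Q : place K^o, ramified F Q -> totally_ramified F Q.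
Hypothesis towL : tower p n L.
Hypothesis PlE : forall i j, (j <= n)%N ->
  lies_over (Pl i j) (finite_place (alpha i)).
Hypothesis stdL : standard_form p n y B Pl lambda.
Hypothesis PE : forall i, lies_over (P i) (finite_place (alpha i)).

Local Notation N := (p ^ n)%N.
Local Notation Y j := (vsval (y j)).
Local Notation Y_ := (fun j => vsval (y j)).

Let prime_p : prime p := pcharf_prime charp.
Let p_gt1 : (1 < p)%N := prime_gt1 prime_p.
Let p_gt0 : (0 < p)%N := prime_gt0 prime_p.
Let charF : p \in [pchar F] := pchar_ext charp F.

Let L0 : L 0 = 1%AS. Proof. by case: towL. Qed.
Let Ln : L n = {:F}%AS. Proof. by case: towL. Qed.
Let Ly j : (j < n)%N -> <<L j; Y j.+1>>%VS = L j.+1.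
Proof. exact: (sf_gen stdL). Qed.
Let yL j : (j < n)%N -> Y j.+1 ^+ p - Y j.+1 \in L j.
Proof. by move=> jn; rewrite (sf_eq stdL jn); apply: subvsP. Qed.

Let N_gt0 : (0 < N)%N. Proof. by rewrite expn_gt0 p_gt0. Qed.

(** * Total ramification *)

Lemma place_totally_ramified l :
  (forall f, P l f%:A = N%:Z * finite_place (alpha l) f) /\
  forall Q, lies_over Q (finite_place (alpha l)) -> Q = P l.
Proof.
have [Q [[_ ramQ] uniqQ]] : totally_ramified F (finite_place (alpha l)).
  by apply: totram; apply/ramE; exists l.
by rewrite (uniqQ _ (PE l)) -degF.
Qed.

Lemma ramP l f : P l f%:A = N%:Z * finite_place (alpha l) f.
Proof. by case: (place_totally_ramified l). Qed.

Lemma uniqP l Q : lies_over Q (finite_place (alpha l)) -> Q = P l.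
Proof. by case: (place_totally_ramified l) => _; apply. Qed.

(** P l is the only place above its restriction. *)
Lemma conjP l (x : gal_of {:F}) f : P l (x f) = P l f.
Proof.
rewrite -[LHS]/(conj_place x (P l) f); congr (val_at _ _); apply: uniqP.
by exists N; split=> // g; rewrite /= gal_alg ramP.
Qed.

Lemma pge_conjP l (x : gal_of {:F}) M f : pge (P l) M f -> pge (P l) M (x f).
Proof. by rewrite /pge fmorph_eq0 conjP. Qed.

Lemma residuesP l : constant_residues (P l).
Proof. by apply: ram_residues (ramP l) degF (@finite_place_residues _ _). Qed.

Lemma generator :
  exists2 x : gal_of {:F}, ('Gal({:F} / 1) = <[x]>)%g & #[x]%g = N.
Proof.
have /cyclicP[x ex] := cycF; exists x => //.
by rewrite orderE -ex -galois_dim // dimv1 divn1 degF.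
Qed.

Definition lin i : K := tofrac ('X - (alpha i)%:P).

Lemma lin_neq0 i : lin i != 0.
Proof. by rewrite tofrac_eq0 polyXsubC_eq0. Qed.

Lemma lin_alg_neq0 (E : fieldExtType K) i : (lin i)%:A != 0 :> E.
Proof. by rewrite scaler_eq0 negb_or lin_neq0 oner_neq0. Qed.

Lemma lin_val i l : finite_place (alpha l) (lin i) = (i == l)%:Z.
Proof. by rewrite finite_val_lin (inj_eq alpha_inj). Qed.

Lemma lies_over_lin (E : fieldExtType K) (Q : place E) i :
  lies_over Q (finite_place (alpha i)) -> 0 < Q (lin i)%:A.
Proof. by case=> e [e0 ->]; rewrite lin_val eqxx mulr1 ltz_nat. Qed.

Lemma pole_place j (R : place (subvs_of (L j))) : (j < n)%N -> R (B j.+1) < 0 ->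
  exists i, R = Pl i j.
Proof.
move=> jn Rneg; have [A [_ RE R0]] := sf_div stdL jn.
apply: contrapT => nR; move: (Rneg); rewrite RE coeffB (R0 _ Rneg) sub0r.
rewrite raddf_sum big1 ?oppr0 ?ltxx // => i _ /=; rewrite coeffU.
by case: eqP => [e|]; rewrite ?mulr0 //; case: nR; exists i.
Qed.

Lemma lambda_gt0_coprime l j : (j < n)%N -> lambda l j.+1 != 0 ->
  coprime (lambda l j.+1) p.
Proof.
by move=> jn l0; case: (sf_coprime stdL l jn) => // e; rewrite e in l0.
Qed.

(** An integral generator y would be congruent to a constant c modulo P l, and
    so would be its conjugate y + m, since P l is the only place above its
    restriction; then the nonzero constant m would vanish at P l. *)
Lemma generator_pole l j : (j < n)%N -> P l (Y j.+1) < 0.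
Proof.
move=> jn; rewrite ltNge; apply/negP => Yint.
have [c hc] : exists c, pge (P l) 1 (Y j.+1 - const F c).
  by apply: residuesP; rewrite /pge Yint orbT.
have [x _ ox] := generator.
(* The conjugating automorphism generates the Galois group of F over L j. *)
have [m em] := @artin_schreier_conj K F p charF (x ^+ (p ^ j))%g (L j) (Y j.+1)
  (fun a => @tower_fixed K F p charF n L Y_ x L0 Ly yL j a (ltnW jn)) (yL jn).
have := em 1%N; rewrite expg1 mul1r => {}em.
have m0 : m%:R != 0 :> F.
  have := @tower_moved K F p charF n L Y_ x ox L0 Ln Ly yL j jn.
  by rewrite em; apply: contraNneq => ->; rewrite addr0.
have := pge_conjP (x ^+ (p ^ j))%g hc; rewrite rmorphB /= em gal_alg => hc'.
have := pgeB hc' hc; rewrite opprB addrA subrK addrAC subrr add0r.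
rewrite pgeE // -(rmorph_nat (@const k F)) val_at_const //.
by move: m0; rewrite -(rmorph_nat (@const k F)) fmorph_eq0.
Qed.

Lemma restrictP l j : exists (R : place (subvs_of (L j))) (e : nat),
  (0 < e)%N /\ forall f, P l (vsval f) = e%:Z * R f.
Proof.
apply: (@restrict_place k (subvs_of (L j)) F vsval (P l)).
  exact: vsval_const.
exists (lin l)%:A; first exact: lin_alg_neq0.
rewrite [X in P l X](vsval_alg (L j)) ramP lin_val eqxx mulr1.
by rewrite -[0]/(Posz 0) eqz_nat -lt0n.
Qed.

Definition index_over l j (e : nat) : Prop := (0 < e)%N /\
  exists R : place (subvs_of (L j)), forall f, P l (vsval f) = e%:Z * R f.

(** In y ^ p - y = B the right-hand side has a pole of order e * lambda at P l,
    with lambda prime to p; as p divides that order, p divides e / e'. *)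
Lemma index_overS l j e e' : (j < n)%N -> index_over l j e ->
  index_over l j.+1 e' ->
  [/\ (e' * p %| e)%N, (0 < lambda l j.+1)%N &
      (P l (Y j.+1)) *+ p = - (e * lambda l j.+1)%N%:Z].
Proof.
move=> jn [e0 [R RE]] [e'0 [R' R'E]].
have Yneg := generator_pole l jn.
have [_ PB] := place_val_artin_schreier p_gt1 Yneg.
rewrite (sf_eq stdL jn) RE in PB.
have Rneg : R (B j.+1) < 0.
  rewrite -(pmulr_rlt0 _ (_ : 0 < e%:Z)) ?ltz_nat // PB.
  by rewrite pmulrn_llt0.
have [i Ri] := pole_place jn Rneg.
have il : i = l.
  have := lies_over_lin (PlE i (ltnW jn)); rewrite -Ri.
  rewrite -(pmulr_rgt0 _ (_ : 0 < e%:Z)) ?ltz_nat // -RE vsval_alg ramP lin_val.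
  by case: eqP => // _; rewrite mulr0 ltxx.
have [lamE _] := sf_lambda stdL l jn.
rewrite -il -Ri in lamE.
have RB : R (B j.+1) = - (lambda l j.+1)%:Z by rewrite -il lamE opprK.
have lam0 : (0 < lambda l j.+1)%N by move: Rneg; rewrite RB oppr_lt0 ltz_nat.
have PY : (P l (Y j.+1)) *+ p = - (e * lambda l j.+1)%N%:Z.
  by rewrite -PB RB mulrN PoszM.
split=> //.
have Lsub : (L j <= L j.+1)%VS by rewrite -Ly // subv_adjoin.
have [t Rt] := val_at_onto R.
have [g eg] : exists g : nat, e = (e' * g)%N.
  have := RE t; rewrite Rt mulr1 -[vsval t]/(vsval (subvs_incl Lsub t)) R'E.
  case: (R' _) => g; first by rewrite -PoszM => -[<-]; exists g.
  by rewrite NegzE mulrN -PoszM; clear -e0; lia.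
move: PY; rewrite R'E -mulr_natr natz -mulrA eg -mulnA PoszM -mulrN.
have e'N : e'%:Z != 0 by rewrite -[0]/(Posz 0) eqz_nat -lt0n.
move/(mulfI e'N) => /(congr1 (fun z => `|z|%N)).
rewrite abszM abszN !absz_nat => gl.
rewrite dvdn_pmul2l // -(Gauss_dvdl _ (_ : coprime p (lambda l j.+1))).
  by rewrite -gl dvdn_mull.
by rewrite coprime_sym lambda_gt0_coprime // -lt0n.
Qed.

Lemma index_over_exists l j : exists e, index_over l j e.
Proof.
by have [R [e [e0 RE]]] := restrictP l j; exists e; split=> //; exists R.
Qed.

Lemma index_over_dvd l j e : (j <= n)%N -> index_over l j e ->
  (e %| p ^ (n - j))%N.
Proof.
elim: j e => [|j IH] e jn he.
  case: he => e0 [R RE]; have := RE (lin l)%:A.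
  rewrite vsval_alg ramP lin_val eqxx mulr1 subn0 => eN.
  have := congr1 (fun z => `|z|%N) eN; rewrite abszM !absz_nat => ->.
  exact: dvdn_mulr.
have [e1 he1] := index_over_exists l j.
have [d _ _] := index_overS jn he1 he.
have := dvdn_trans d (IH _ (ltnW jn) he1).
by rewrite -(subnSK jn) expnSr dvdn_pmul2r.
Qed.

Lemma dvd_index_over l i j e : (i + j)%N = n -> index_over l j e ->
  (p ^ i %| e)%N.
Proof.
elim: i j e => [|i IH] j e ijn he; first exact: dvd1n.
have [e1 he1] := index_over_exists l j.+1.
have jn : (j < n)%N by rewrite -ijn addSn ltnS leq_addl.
have [d _ _] := index_overS jn he he1.
apply: dvdn_trans d; rewrite expnSr dvdn_pmul2r //.
by apply: IH he1; rewrite addnS.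
Qed.

(** Each of the n steps takes at least a factor p from the total index p ^ n, so
    each takes exactly p. *)
Lemma index_overE l j e : (j <= n)%N -> index_over l j e -> e = (p ^ (n - j))%N.
Proof.
move=> jn he; apply/eqP; rewrite eqn_dvd (index_over_dvd jn he).
by apply: dvd_index_over he; rewrite subnK.
Qed.

Lemma generator_order l j : (j < n)%N ->
  coprime (lambda l j.+1) p /\
  P l (Y j.+1) = - (lambda l j.+1 * p ^ (n - j.+1))%N%:Z.
Proof.
move=> jn; have [e he] := index_over_exists l j.
have [e' he'] := index_over_exists l j.+1.
have [_ lam0 PY] := index_overS jn he he'; split.
  by apply: lambda_gt0_coprime => //; rewrite -lt0n.
have pN : (p%:Z : int) != 0 by rewrite -[0]/(Posz 0) eqz_nat -lt0n.
apply: (mulIf pN); move: PY; rewrite -mulr_natr natz => ->.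
rewrite (index_overE (ltnW jn) he) -(subnSK jn) expnSr mulNr -PoszM.
congr (- _%:Z).
by rewrite -mulnA [(p * _)%N]mulnC mulnA [(_ * lambda _ _)%N]mulnC.
Qed.

(** * Places outside the ramification locus *)

(** A pole of a generator is a pole of the right-hand side of its equation, and
    those lie over the points alpha i only. *)
Lemma generator_int (Q : place F) j : (j < n)%N -> (forall l, Q != P l) ->
  pge Q 0 (Y j.+1).
Proof.
move=> jn nQ; rewrite /pge; apply/orP; right; rewrite leNgt; apply/negP => Yneg.
have [B0 QB] := place_val_artin_schreier p_gt1 Yneg.
rewrite (sf_eq stdL jn) in B0 QB.
have Bneg : Q (vsval (B j.+1)) < 0 by rewrite QB pmulrn_llt0.
have [|R [e [e0 RE]]] := @restrict_place k (subvs_of (L j)) F vsval Q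
    (@vsval_const _ _ _).
  by exists (B j.+1); [exact: (sf_neq0 stdL jn) | rewrite lt_eqF].
have [i Ri] : exists i, R = Pl i j.
  apply: pole_place jn _; rewrite -(pmulr_rlt0 _ (_ : 0 < e%:Z)) ?ltz_nat //.
  by rewrite -RE.
have [e' [e'0 Re']] := PlE i (ltnW jn).
case/eqP: (nQ i); apply: uniqP; exists (e * e')%N; split=> [|f].
  by rewrite muln_gt0 e0.
rewrite PoszM -mulrA -Re' -Ri -RE; congr (val_at _ _).
by rewrite [RHS](vsval_alg (L j)).
Qed.

Section Extend.
Variable q : place K^o.
Hypothesis qres : constant_residues q.
Hypothesis q_lin : forall i, q (lin i) <= 0.

(** A pole of B j.+1 lies over some alpha i, whereas q gives lin i no positive
    order, so each step is the integral case. *)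
Lemma extend_place_tower j : (j <= n)%N ->
  exists2 V : place (subvs_of (L j)), constant_residues V &
    forall c, V c%:A = q c.
Proof.
elim: j => [_|j IH jn].
  have [|f|V [VE Vres]] := @transport_place k K^o (subvs_of (L 0))
    (in_alg (subvs_of (L 0))) _ _ q qres.
  - by move=> c; rewrite constK.
  - have : vsval f \in (1%AS : {subfield F}) by rewrite -L0 subvsP.
    move=> /vlineP[c ec]; exists c; apply: val_inj.
    by rewrite [LHS](vsval_alg (L 0)).
  by exists V.
have [V Vres VE] := IH (ltnW jn).
have Bint : pge V 0 (B j.+1).
  rewrite /pge; apply/orP; right; rewrite leNgt.
  apply/negP => /(pole_place jn)[i Vi].
  have := lies_over_lin (PlE i (ltnW jn)); rewrite -Vi VE.
  by rewrite ltNge q_lin.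
have dimL : \dim_(L j) (L j.+1) = p by case: towL => _ _ /(_ j jn)[].
have [V' V'res V'E] :=
  extend_place charp (sf_eq stdL jn) (Ly jn) dimL Vres Bint.
exists V' => // c; rewrite -VE; apply: V'E.
by rewrite [LHS](vsval_alg (L j)) [RHS](vsval_alg (L j.+1)).
Qed.

Lemma extend_to_top : exists V : place F, forall c, V c%:A = q c.
Proof.
have [V Vres VE] := extend_place_tower (leqnn n).
have [|f|W [WE _]] := @transport_place k (subvs_of (L n)) F vsval _ _ V Vres.
- exact: vsval_const.
- have fL : f \in L n by rewrite Ln memvf.
  by exists (Subvs fL).
exists W => c; rewrite -VE -WE; congr (val_at _ _).
by rewrite [RHS](vsval_alg (L n)).
Qed.

End Extend.

(** * The monomial basis and its dual for the trace *)

Definition basis_elt (m : nat) : F :=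
  monomial (fun j => vsval (y j)) (fun l => digit p m l.+1) n.

Lemma basis_elt_val l m : basis_elt m != 0 /\
  P l (basis_elt m) = - (pole_order p n (lambda l) m)%:Z.
Proof.
have Y0 (j : 'I_n) : Y j.+1 != 0.
  have := generator_pole l (ltn_ord j).
  by apply: contraTneq => ->; rewrite val_at0 ltxx.
split; first by apply/prodf_neq0 => j _; rewrite expf_neq0.
rewrite /basis_elt /monomial place_val_prod => [|j]; last by rewrite expf_neq0.
rewrite /pole_order big_add1 /= big_mkord -[Posz _]natz natr_sum -sumrN.
apply: eq_bigr => j _; rewrite place_valX (generator_order l (ltn_ord j)).2.
by rewrite natz -mulnA -mulr_natr natz mulNr -PoszM mulnC.
Qed.

Lemma basis_elt_int (Q : place F) m :
  (forall l, Q != P l) -> pge Q 0 (basis_elt m).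
Proof.
move=> nQ; apply: pge_prod => j _; apply: pgeX; exact: generator_int.
Qed.

Lemma lambda_coprime l j : (0 < j <= n)%N -> coprime (lambda l j) p.
Proof. by case: j => // j /andP[_ jn]; case: (generator_order l jn). Qed.

Lemma basis_val_distinct l (i j : 'I_N) (z : int) :
  P l (basis_elt i) = P l (basis_elt j) + N%:Z * z -> i = j.
Proof.
rewrite !(basis_elt_val l _).2 => e; apply: val_inj.
apply: (@pole_order_inj p n p_gt1 (lambda l) _ _ (@lambda_coprime l)
  (ltn_ord i) (ltn_ord j)).
have : (pole_order p n (lambda l) i)%:Z =
    - z * N%:Z + (pole_order p n (lambda l) j)%:Z.
  by rewrite mulNr mulrC; lia.
move=> /(congr1 (fun a => (a %% N%:Z)%Z)); rewrite modzMDl !modz_nat.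
by case.
Qed.

Lemma basis_span (l : 'I_s) f :
  exists c : 'I_N -> K, f = \sum_i c i *: basis_elt i.
Proof.
apply: (ram_basis_span (ramP l) degF) => [i|]; last exact: basis_val_distinct.
by case: (basis_elt_val l i).
Qed.

Lemma basis_pge l (c : 'I_N -> K) M : pge (P l) M (\sum_i c i *: basis_elt i) ->
  forall i, pge (P l) M (c i *: basis_elt i).
Proof.
apply: (ram_basis_min (ramP l)) => [i|]; last exact: basis_val_distinct.
by case: (basis_elt_val l i).
Qed.

Lemma basis_valZ l (c : K) m : c != 0 ->
  P l (c *: basis_elt m) =
  N%:Z * finite_place (alpha l) c - (pole_order p n (lambda l) m)%:Z.
Proof.
by move=> c0; have [b0 <-] := basis_elt_val l m; apply: (ram_valZ (ramP l)).
Qed.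

Definition Tr (z : F) : F := galTrace 1%AS {:F}%AS z.

Lemma TrE : exists2 x : gal_of {:F}, #[x]%g = N &
  forall z, Tr z = tower_trace p x n z.
Proof.
have [x ex ox] := generator; exists x => // z.
by rewrite /Tr (galTrace_cycle z ex) ox.
Qed.

Lemma TrZ (c : K) z : Tr (c *: z) = c *: Tr z.
Proof.
have [x _ TE] := TrE; rewrite !TE /tower_trace scaler_sumr.
by apply: eq_bigr => i _; rewrite linearZ.
Qed.

Lemma Tr_sum (I : Type) (r : seq I) (A : pred I) (z : I -> F) :
  Tr (\sum_(i <- r | A i) z i) = \sum_(i <- r | A i) Tr (z i).
Proof. exact: raddf_sum. Qed.

Lemma pge_Tr (Q : place F) M z : (forall x : gal_of {:F}, pge Q M (x z)) ->
  pge Q M (Tr z).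
Proof.
move=> h; have [x _ ->] := TrE; rewrite /tower_trace big_mkord.
by apply: pge_sum => i _; apply: h.
Qed.

Lemma basis_elt_mul m1 m2 : basis_elt m1 * basis_elt m2 =
  monomial (fun j => vsval (y j))
    (fun l => digit p m1 l.+1 + digit p m2 l.+1)%N n.
Proof.
rewrite /basis_elt /monomial -big_split.
by apply: eq_bigr => i _; rewrite exprD.
Qed.

Lemma Tr_dual m : (m < N)%N ->
  Tr (basis_elt m * basis_elt (N.-1 - m)) = (-1) ^+ n.
Proof.
move=> mN; have [x ox ->] := TrE; rewrite basis_elt_mul.
apply: (@tower_trace_top K F p charF n L Y_ x ox L0 Ln Ly yL) => // l ln.
by rewrite (digit_compl p_gt1 mN) // subnKC // digit_le.
Qed.

(** Since the digits of m and of p ^ n - 1 - m add up to p - 1, the trace form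
    is triangular in the monomial basis. *)
Lemma Tr_dual_lt m1 m : (m1 < m)%N -> (m < N)%N ->
  Tr (basis_elt m1 * basis_elt (N.-1 - m)) = 0.
Proof.
move=> m1m mN; have [x ox ->] := TrE; rewrite basis_elt_mul.
have [[|j] // jn [lt eq]] := digit_lex m1m mN.
have dc l : (l < n)%N -> digit p (N.-1 - m) l.+1 = (p.-1 - digit p m l.+1)%N.
  by move=> ln; rewrite (digit_compl p_gt1 mN).
have jn' : (j < n)%N by case/andP: jn.
apply: (@tower_trace_lower K F p charF n L Y_ x ox L0 Ln Ly yL _ j).
- by rewrite jn' leqnn.
- rewrite dc //; move: lt (digit_le p_gt1 m j.+1); clear; lia.
- move=> l /andP[jl ln]; rewrite dc // eq ?subnKC ?digit_le //.
  by rewrite ltnS jl.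
Qed.

(** * Functions regular outside one ramified place *)

(** The coefficients of a function in the monomial basis, recovered from the
    last to the first by pairing with the dual basis, stay integral. *)
Lemma coef_int (V : place F) (c : 'I_N -> K) :
  (forall (x : gal_of {:F}) m, pge V 0 (x (basis_elt m))) ->
  (forall x : gal_of {:F}, pge V 0 (x (\sum_i c i *: basis_elt i))) ->
  forall i, pge V 0 (c i)%:A.
Proof.
move=> wV fV i.
have [m] := ubnP (N - i); elim: m i => // m IH i im.
have iN := ltn_ord i.
have TV z : (forall x : gal_of {:F}, pge V 0 (x z)) ->
    pge V 0 (Tr (z * basis_elt (N.-1 - i))).
  move=> zV; apply: pge_Tr => x; rewrite rmorphM.
  by apply: pgeM0; [exact: zV | exact: wV].
suff : pge V 0 (c i *: Tr (basis_elt i * basis_elt (N.-1 - i))).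
  rewrite Tr_dual // -[c i *: _]mulr_algl -signr_odd.
  by case: (odd n); rewrite ?mulrN1 ?mulr1 ?pgeN.
rewrite -TrZ scalerAl.
have -> : c i *: basis_elt i =
    \sum_i c i *: basis_elt i - \sum_(j | j != i) c j *: basis_elt j.
  by rewrite (bigD1 i) //= addrK.
rewrite mulrBl [Tr _]raddfB /= -/(Tr _) -/(Tr _); apply: pgeB; first exact: TV.
rewrite mulr_suml Tr_sum; apply: pge_sum => j ji.
rewrite -scalerAl TrZ.
have [lt|gt|e] := ltngtP j i; last by case/eqP: ji; exact: val_inj.
  by rewrite Tr_dual_lt // scaler0 pge0.
rewrite -mulr_algl; apply: pgeM0; last by apply: TV => x; apply: wV.
by apply: IH; have := ltn_ord j; clear -gt im iN; lia.
Qed.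

Lemma above_unramified (V : place F) l :
  V (lin l)%:A <= 0 -> V != P l.
Proof.
apply: contraTneq => ->; rewrite -ltNge; exact: lies_over_lin (PE l).
Qed.

(** The conjugates of an extension V of q are again places above q, where the
    function is regular; so all its conjugates are regular at V. *)
Lemma coef_regular l (c : 'I_N -> K) (q : place K^o) :
  (forall Q : place F, Q != P l -> pge Q 0 (\sum_i c i *: basis_elt i)) ->
  constant_residues q -> (forall i, q (lin i) <= 0) ->
  forall i, pge q 0 (c i : K^o).
Proof.
move=> freg qres qlin i.
have [V VE] := extend_to_top qres qlin.
have conjV (x : gal_of {:F}) l' : conj_place x V != P l'.
  by apply: above_unramified; rewrite /= gal_alg VE.
have := @coef_int V c _ _ i; rewrite /pge VE scaler_eq0 oner_eq0 orbF; apply.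
  move=> x m; have := @basis_elt_int (conj_place x V) m (conjV x).
  by rewrite /pge fmorph_eq0.
move=> x; have := freg (conj_place x V) (conjV x l).
by rewrite /pge fmorph_eq0.
Qed.

(** At each place P i no term of the expansion of f has smaller order than f,
    and elsewhere the coefficients are regular because f is. So a term with the
    same order as f at P l provides m and c. *)
Lemma nongap_coef l a f : (0 < a)%N -> f != 0 ->
  pole_divisor_is f << a%:Z *g P l >> ->
  exists (m : 'I_N) (c : K), [/\ c != 0,
     N%:Z * finite_place (alpha l) c - (pole_order p n (lambda l) m)%:Z =
       - a%:Z,
     forall i, i != l ->
       0 <= N%:Z * finite_place (alpha i) c - (pole_order p n (lambda i) m)%:Z
   & \sum_i finite_place (alpha i) c <= 0].
Proof.
move=> a0 f0 fdiv.
have fP : P l f = - a%:Z.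
  have := fdiv (P l); rewrite coeffU eqxx mulr1 => e.
  by clear -a0 e; lia.
have freg Q : Q != P l -> pge Q 0 f.
  move=> QP; have := fdiv Q; rewrite coeffU eq_sym (negPf QP) mulr0 pgeE //.
  by clear; lia.
have [c fc] := basis_span l f.
have [m hm] : exists m, ~~ pge (P l) (- a%:Z + 1) (c m *: basis_elt m).
  apply/existsP; apply: contraT; rewrite negb_exists => /forallP h.
  have : pge (P l) (- a%:Z + 1) f.
    by rewrite fc; apply: pge_sum => i _; have := h i; rewrite negbK.
  by rewrite pgeE // fP gerDl ler10.
have hm' : pge (P l) (- a%:Z) (c m *: basis_elt m).
  by apply: basis_pge; rewrite -fc -fP pgexx.
have cm0 : c m != 0.
  by apply: contraNneq hm => ->; rewrite scale0r pge0.
exists m, (c m); split=> //.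
- by rewrite -(basis_valZ l m cm0); apply: place_val_eq.
- move=> i il; rewrite -(basis_valZ i m cm0).
  have : pge (P i) 0 (c m *: basis_elt m).
    apply: basis_pge; rewrite -fc; apply: freg.
    apply: contraNneq il => e; have := lies_over_lin (PE i).
    by rewrite e ramP lin_val; case: eqP => // _; rewrite mulr0 ltxx.
  by rewrite pgeE // scaler_eq0 negb_or cm0; case: (basis_elt_val i m).
rewrite fc in freg.
apply: sum_finite_val_le0 => // [b nb|].
  have := @coef_regular l c (finite_place b) freg (@finite_place_residues _ b).
  rewrite -(pgeE (finite_place b) 0 cm0); apply => i.
  by rewrite finite_val_lin eq_sym (negPf (nb i)).
have := @coef_regular l c (infinite_place k) freg (@infinite_place_residues _).
rewrite -(pgeE (infinite_place k) 0 cm0); apply => i.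
by rewrite infinite_val_lin.
Qed.

(** The function is a basis monomial times a product of powers of linear
    factors; the bound on the sum of the exponents makes that product regular at
    infinity. *)
Lemma nongap_construct l a (m : nat) (z : 'I_s -> int) : (0 < a)%N ->
  N%:Z * z l - (pole_order p n (lambda l) m)%:Z = - a%:Z ->
  (forall i, i != l -> 0 <= N%:Z * z i - (pole_order p n (lambda i) m)%:Z) ->
  \sum_i z i <= 0 ->
  exists f : F, f != 0 /\ pole_divisor_is f << a%:Z *g P l >>.
Proof.
move=> a0 zl zi zs.
pose c : F := \prod_i ((lin i)%:A : F) ^ z i.
have l0 i : (lin i)%:A != 0 :> F := lin_alg_neq0 F i.
have c0 : c != 0 := prodXz_neq0 z l0.
have wm0 : basis_elt m != 0 by case: (basis_elt_val l m).
have cP i : P i c = N%:Z * z i.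
  rewrite place_val_prodXz // (bigD1 i) //= big1 ?addr0 => [|j ji].
    by rewrite ramP lin_val eqxx mulr1 mulrC.
  by rewrite ramP lin_val (negPf ji) !mulr0.
exists (c * basis_elt m); split; first by rewrite mulf_neq0.
move=> Q; rewrite coeffU val_atM //.
have [<-|QP] := eqVneq (P l) Q.
  by rewrite mulr1 cP (basis_elt_val l m).2; clear -zl; lia.
rewrite mulr0; suff : 0 <= Q c + Q (basis_elt m) by clear; lia.
have [/existsP[i /eqP Qi]|nQ] := boolP [exists i, Q == P i].
  rewrite Qi cP (basis_elt_val i m).2; apply: zi.
  by apply: contraNneq QP => <-; rewrite Qi.
have nQP i : Q != P i.
  by apply: contraNneq nQ => e; apply/existsP; exists i; rewrite e.
have w_ge0 : 0 <= Q (basis_elt m) by have := basis_elt_int m nQP; rewrite pgeE.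
suff c_ge0 : 0 <= Q c by rewrite addr_ge0.
have lin_le0 i : Q (lin i)%:A <= 0.
  rewrite leNgt; apply/negP => /lies_over_pos /uniqP e.
  by case/eqP: (nQP i).
(* Linear factors differ by constants: once one of them has a pole at Q, all
   have the same pole order there. *)
have linE i : Q (lin i)%:A = Q (lin l)%:A.
  have := lin_le0 l; rewrite le_eqVlt => /orP[/eqP e|]; last exact: lin_pole_eq.
  have := lin_le0 i; rewrite le_eqVlt e => /orP[/eqP //|neg].
  by have := lin_pole_eq (alpha l) neg; rewrite -/(lin l) e.
rewrite place_val_prodXz //; under eq_bigr do rewrite linE.
by rewrite -mulr_suml mulr_le0.
Qed.

(** * The different exponent *)

Lemma integralP l f :
  integral_over (finite_place (alpha l)) f <-> pge (P l) 0 f.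
Proof.
split; first exact: (integral_pge (ramP l)).
move=> h; apply: (pge_integral N_gt0 (ramP l) galF) => x; exact: pge_conjP.
Qed.

Lemma basis_elt0 : basis_elt 0 = 1.
Proof.
rewrite /basis_elt /monomial big1 // => i _.
by rewrite /digit div0n mod0n expr0.
Qed.

Lemma Tr_basis_elt m : (m < N)%N ->
  Tr (basis_elt m) = (m == N.-1)%:R * (-1) ^+ n.
Proof.
move=> mN; have topN : (N.-1 < N)%N by rewrite ltn_predL.
have e : basis_elt m = basis_elt m * basis_elt (N.-1 - N.-1).
  by rewrite subnn basis_elt0 mulr1.
rewrite e; case: eqP => [->|/eqP ne]; first by rewrite Tr_dual // mul1r.
rewrite Tr_dual_lt ?mul0r // ltn_neqAle ne -ltnS (ltn_predK N_gt0).
exact: mN.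
Qed.

Lemma signr_alg : (-1) ^+ n = ((-1) ^+ n)%:A :> F.
Proof. by rewrite -[RHS]/(in_alg F _) rmorphXn rmorphN1. Qed.

Lemma Tr_expand (c : 'I_N -> K) (top : 'I_N) : val top = N.-1 ->
  Tr (\sum_i c i *: basis_elt i) = (c top * (-1) ^+ n)%:A.
Proof.
move=> et; rewrite Tr_sum (bigD1 top) //= big1 ?addr0 => [|i ni].
  rewrite TrZ Tr_basis_elt ?ltn_ord // [(top : nat)]et eqxx mul1r signr_alg.
  by rewrite scalerA.
rewrite TrZ Tr_basis_elt ?ltn_ord // -et (inj_eq val_inj) (negPf ni) mul0r.
exact: scaler0.
Qed.

Lemma finite_val_sign l (c : K) : finite_place (alpha l) (c * (-1) ^+ n : K) =
  finite_place (alpha l) (c : K^o).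
Proof.
rewrite -signr_odd; case: (odd n); rewrite ?mulrN1 ?mulr1 //.
exact: (@place_valN k K^o).
Qed.

(** Up to sign the trace is the last coordinate c of z. A pole of c would add at
    least N to the pole order of basis_elt N.-1, one more than z allows. *)
Lemma Tr_integral l z :
  pge (P l) (- (pole_order p n (lambda l) N.-1 + N.-1)%N%:Z) z ->
  exists c : K, Tr z = c%:A /\ 0 <= finite_place (alpha l) c.
Proof.
move=> hz; have topN : (N.-1 < N)%N by rewrite ltn_predL.
pose top := Ordinal topN.
have [c zc] := basis_span l z; exists (c top * (-1) ^+ n).
rewrite zc (Tr_expand c (top := top)) //; split=> //.
rewrite finite_val_sign.
have [->|c0] := eqVneq (c top) 0; first by rewrite val_at0.
have := basis_pge (l := l) (c := c)
  (M := - (pole_order p n (lambda l) N.-1 + N.-1)%N%:Z).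
rewrite -zc => /(_ hz top); rewrite pgeE; last first.
  by rewrite scaler_eq0 negb_or c0; case: (basis_elt_val l top).
by rewrite basis_valZ //; apply: mul_ge_opp_pred.
Qed.

(** The bound of [Tr_integral] is sharp: basis_elt N.-1 / (x - alpha l) has pole
    order larger by one, and its trace is not integral. *)
Lemma different_exponentE l d :
  different_exponent (P l) (finite_place (alpha l)) d ->
  d = (pole_order p n (lambda l) N.-1 + N.-1)%N%:Z.
Proof.
case=> t [t0 tP ->]; set D := (_ + _)%N.
have topN : (N.-1 < N)%N by rewrite ltn_predL.
apply/eqP; rewrite eq_le; apply/andP; split; last first.
  have [u Pu] := val_at_onto (P l).
  have u0 : u != 0 by apply: contraTneq isT => e; move: Pu; rewrite e val_at0.
  pose z := (u ^+ D)^-1.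
  have z0 : z != 0 by rewrite invr_eq0 expf_neq0.
  have Pz : P l z = - D%:Z by rewrite place_valV place_valX Pu natz.
  have : complementary (finite_place (alpha l)) z.
    move=> v /integralP hv; apply: Tr_integral.
    have hz : pge (P l) (- D%:Z) z by rewrite -Pz pgexx.
    by have := pgeM hz hv; rewrite addr0.
  move=> /tP /integralP; have [zt0 zt] := place_val_div (P l) z0 t0.
  by rewrite pgeE // zt Pz; clear; lia.
rewrite leNgt; apply/negP => tD.
have [b0 _] := basis_elt_val l N.-1.
have li0 : (lin l)^-1 != 0 by rewrite invr_eq0 lin_neq0.
have li1 : finite_place (alpha l) (lin l)^-1 = -1.
  rewrite [LHS](@place_valV k K^o (finite_place (alpha l)) (lin l)).
  by rewrite lin_val eqxx.
pose z := (lin l)^-1 *: basis_elt N.-1.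
have z0 : z != 0 by rewrite scaler_eq0 negb_or li0.
have Pz : P l z = - N%:Z - (pole_order p n (lambda l) N.-1)%:Z.
  by rewrite /z basis_valZ // li1 mulrN1.
have zt_int : integral_over (finite_place (alpha l)) (z / t).
  apply/integralP; have [zt0 zt] := place_val_div (P l) z0 t0.
  rewrite pgeE // zt Pz; move: tD; rewrite /D; clear -N_gt0.
  by move: (p ^ n)%N (P l t) (pole_order _ _ _ _) N_gt0 => M a b; lia.
have one_int : integral_over (finite_place (alpha l)) (1 : F).
  by apply/integralP; exact: (pge_nat (P l) 1).
have [c [cE cint]] := (tP z).2 zt_int 1 one_int.
have : c%:A = ((lin l)^-1 * (-1) ^+ n)%:A :> F.
  rewrite -cE mulr1 -/(Tr z) /z TrZ Tr_basis_elt // eqxx mul1r signr_alg.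
  by rewrite scalerA.
move=> /(fmorph_inj (in_alg F)) ec.
by move: cint; rewrite ec finite_val_sign li1.
Qed.

(** * Boseck invariants and gaps *)

Variable delta : 'I_s -> int.
Hypothesis deltaE : forall i,
  different_exponent (P i) (finite_place (alpha i)) (delta i).

Local Notation nu := (nu p n delta lambda).
Local Notation rho := (rho p n delta lambda).
Local Notation boseck := (boseck p n delta lambda).
Local Notation pole i m := (pole_order p n (lambda i) m).

Lemma rho_bounds i m : 0 <= rho i m < N%:Z.
Proof.
rewrite /Defs.rho /Defs.nu.
move: (boseck_num _ _ _ _ _ _) => b.
rewrite {1 3}(divz_eq b N%:Z) [_ * _ + _]addrC !addrK.
by rewrite modz_ge0 ?ltz_pmod // -lt0n.
Qed.

(** Complementing the digits of m turns nu into the rounded up quotient of the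
    pole order of the basis monomial by p ^ n. *)
Lemma nu_rho_compl i m : (m < N)%N ->
  (N.-1 + pole i m)%N%:Z = nu i (N.-1 - m) * N%:Z + rho i (N.-1 - m).
Proof.
move=> mN; rewrite /Defs.rho addrC subrK /boseck_num.
rewrite (different_exponentE (deltaE i)).
rewrite -[X in (_ - (X)%:Z)]/(pole i (N.-1 - m)).
have := pole_order_compl p_gt1 (lambda i) mN.
by move: (pole i _) (pole i m) (pole i _) => a b c; clear; lia.
Qed.

Lemma rho_compl i m : (m < N)%N ->
  N%:Z * (nu i (N.-1 - m) - 1) - (pole i m)%:Z = - (rho i (N.-1 - m) + 1).
Proof.
move=> mN; have := nu_rho_compl i mN; rewrite mulrBr mulr1 [N%:Z * _]mulrC.
move: (nu _ _ * _) (rho _ _) (pole i m) => q r u; clear -N_gt0.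
by move: (p ^ n)%N N_gt0 => M; lia.
Qed.

(** The value p ^ n would need a pole order divisible by p ^ n, which only the
    monomial 1 has. *)
Lemma rho_compl_pos i m : (0 < m < N)%N -> rho i (N.-1 - m) + 1 < N%:Z.
Proof.
move=> /andP[m0 mN]; have /andP[_ rN] := rho_bounds i (N.-1 - m).
rewrite lt_neqAle lezD1 rN andbT; apply/negP => /eqP e.
have := rho_compl i mN; rewrite e => e'.
suff : m = 0%N by move=> em; rewrite em in m0.
apply: (@pole_order_inj p n p_gt1 (lambda i) _ _ (@lambda_coprime i) mN N_gt0).
have -> : pole i 0 = 0%N.
  by rewrite /pole_order big1 // => j _; rewrite /digit div0n mod0n.
rewrite mod0n; apply/eqP; rewrite -/(_ %| _)%N.
have [z ez] : exists z : int, (pole i m)%:Z = z * N%:Z.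
  exists (nu i (N.-1 - m)); move: e'; rewrite mulrBr mulr1 [N%:Z * _]mulrC.
  by move: (nu _ _ * _) (pole i m) => q u; clear; lia.
by have := congr1 absz ez; rewrite abszM !absz_nat => ->; apply: dvdn_mull.
Qed.

(** A function with pole divisor a (P i) can only come from basis_elt m. Its
    coefficient must have order at least nu j (N.-1 - m) at the other places P j
    and exactly one less than nu at P i; these orders add up to the Boseck
    invariant minus 1, and a rational function realizing them exists when this
    sum is at most 0. *)
Lemma gap_compl i m a : (0 < m < N)%N -> a%:Z = rho i (N.-1 - m) + 1 ->
  gap (P i) a <-> 2 <= boseck (N.-1 - m).
Proof.
move=> m0N ea; have /andP[m0 mN] := m0N.
have a0 : (0 < a)%N.
  by have /andP[r0 _] := rho_bounds i (N.-1 - m); rewrite -ltz_nat ea ltzD1.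
have pole_nu j : 0 <= N%:Z * nu j (N.-1 - m) - (pole j m)%:Z.
  have := rho_compl j mN; have /andP[_] := rho_bounds j (N.-1 - m).
  rewrite mulrBr mulr1; move: (N%:Z * _) (rho _ _) (pole j m) => q r u.
  by clear; move: (p ^ n)%N => M; lia.
split=> [[_ nf]|G2].
  rewrite leNgt; apply/negP => G1; apply: nf.
  apply: (@nongap_construct i a m
    (fun j => nu j (N.-1 - m) - (j == i)%:Z)) => //.
  - by rewrite eqxx ea rho_compl.
  - by move=> j /negPf ->; rewrite subr0.
  have -> : \sum_j (nu j (N.-1 - m) - (j == i)%:Z) = boseck (N.-1 - m) - 1.
    rewrite sumrB; congr (_ - _); rewrite (bigD1 i) //= eqxx big1 ?addr0 //.
    by move=> j /negPf ->.
  by move: (boseck _) G1 => b; clear; lia.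
split=> // -[f [f0 fdiv]].
have [m2 [c [c0 cl ci cs]]] := nongap_coef a0 f0 fdiv.
have m2m : m2 = m :> nat.
  apply: (@pole_order_inj p n p_gt1 (lambda i) _ _ (@lambda_coprime i)
    (ltn_ord m2) mN).
  have := rho_compl i mN; rewrite -ea -cl => e.
  have : (pole i m2)%:Z =
      (finite_place (alpha i) c - nu i (N.-1 - m) + 1) * N%:Z + (pole i m)%:Z.
    move: e; rewrite mulrBr mulr1 mulrDl mulrBl mul1r.
    rewrite [_ * N%:Z]mulrC [nu _ _ * N%:Z]mulrC.
    move: (N%:Z * _) (N%:Z * _) (pole i m) (pole i m2) => q1 q2 u1 u2; clear.
    by move: (p ^ n)%N => M; lia.
  move=> /(congr1 (fun a => (a %% N%:Z)%Z)); rewrite modzMDl !modz_nat.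
  by case.
rewrite {}m2m in cl ci.
have ci' j : j != i -> nu j (N.-1 - m) <= finite_place (alpha j) c.
  move=> ji; have /andP[r0 rN] := rho_bounds j (N.-1 - m).
  by apply: ceil_le (nu_rho_compl j mN) (ci j ji).
have cl' : finite_place (alpha i) c = nu i (N.-1 - m) - 1.
  have NN : (N%:Z : int) != 0 by rewrite -[0]/(Posz 0) eqz_nat -lt0n.
  apply: (mulfI NN); have := rho_compl i mN; rewrite -ea -cl.
  by move=> /addIr.
suff : boseck (N.-1 - m) - 1 <= 0 by move: (boseck _) G2 => b; clear; lia.
apply: le_trans cs.
rewrite /Defs.boseck (bigD1 i) // [X in _ <= X](bigD1 i) // cl' addrAC.
by rewrite lerD2l; apply: ler_sum => j; apply: ci'.
Qed.

(** The pole orders of the basis monomials represent all classes modulo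
    p ^ n. *)
Lemma rho_surj i a : (1 <= a < N)%N ->
  exists2 m, (0 < m < N)%N & a%:Z = rho i (N.-1 - m) + 1.
Proof.
move=> /andP[a1 aN].
have [m mN em] := pole_order_surj p_gt1 a (@lambda_coprime i).
have m0 : (0 < m)%N.
  rewrite lt0n; apply: contraTneq a1 => m0; move: em; rewrite m0.
  have -> : pole i 0 = 0%N.
    by rewrite /pole_order big1 // => j _; rewrite /digit div0n mod0n.
  by rewrite mod0n modn_small // => <-.
have m0N : (0 < m < N)%N by rewrite m0.
exists m => //.
have /andP[r0 _] := rho_bounds i (N.-1 - m).
have rN := rho_compl_pos i m0N.
have : (pole i m)%:Z = (nu i (N.-1 - m) - 1) * N%:Z + (rho i (N.-1 - m) + 1).
  have := rho_compl i mN; rewrite [N%:Z * _]mulrC.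
  by move: (_ * N%:Z) (pole i m) (rho _ _) => q u r; clear; lia.
move=> /(congr1 (fun a => (a %% N%:Z)%Z)); rewrite modzMDl modz_nat em.
have ha : (0 <= a%:Z < N%:Z) by rewrite ltz_nat aN.
have hr : (0 <= rho i (N.-1 - m) + 1 < N%:Z) by rewrite rN addr_ge0.
by rewrite -modz_nat (modz_small ha) (modz_small hr).
Qed.

Lemma gap_boseck i a : gap (P i) a /\ (a < N)%N <->
  exists m, [/\ (m < N.-1)%N, 2 <= boseck m & a%:Z = rho i m + 1].
Proof.
split=> [[ga aN]|[m' [m'N G ea]]].
  have a1 : (1 <= a)%N by case: ga.
  have [|m m0N ea] := @rho_surj i a; first by rewrite a1.
  exists (N.-1 - m)%N; split=> //; last by apply/(gap_compl m0N ea).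
  by case/andP: m0N; clear; move: (p ^ n)%N => M; lia.
have m'E : m' = (N.-1 - (N.-1 - m'))%N by rewrite subKn // ltnW.
have m0N : (0 < N.-1 - m' < N)%N.
  by rewrite subn_gt0 m'N (leq_ltn_trans (leq_subr _ _)) // ltn_predL.
rewrite m'E in G ea.
split; first by apply/(gap_compl m0N ea).
by rewrite -ltz_nat ea rho_compl_pos.
Qed.

Lemma gap_all i a : (forall m, (m < N.-1)%N -> 2 <= boseck m) ->
  (1 <= a < N)%N -> gap (P i) a.
Proof.
move=> G aN; have [m m0N ea] := rho_surj i aN.
apply/(gap_compl m0N ea)/G.
by case/andP: m0N; clear; move: (p ^ n)%N => M; lia.
Qed.

End CyclicTower.

Theorem lemma40 (k : closedFieldType) (p n s g : nat)
  (F : splittingFieldType (ratfun k)) (alpha : 'I_s -> k)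
  (L : nat -> {subfield F})
  (y : forall j, subvs_of (L j)) (B : forall j, subvs_of (L j.-1))
  (Pl : 'I_s -> forall j, place (subvs_of (L j)))
  (lambda : 'I_s -> nat -> nat)
  (P : 'I_s -> place F) (delta : 'I_s -> int)
  (charp : p \in [pchar k])
  (genusF : is_genus F g) (g_ge2 : (2 <= g)%N)
  (galF : galois 1%AS {:F}%AS) (cycF : cyclic 'Gal({:F} / 1))
  (degF : \dim {:F} = (p ^ n)%N)
  (alpha_inj : injective alpha)
  (ramE : forall Q : place (ratfun k)^o,
     ramified F Q <-> exists i, Q = finite_place (alpha i))
  (totram : forall Q : place (ratfun k)^o,
     ramified F Q -> totally_ramified F Q)
  (towL : tower p n L)
  (PlE : forall i j, (j <= n)%N ->
     lies_over (Pl i j) (finite_place (alpha i)))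
  (stdL : standard_form p n y B Pl lambda)
  (PE : forall i, lies_over (P i) (finite_place (alpha i)))
  (deltaE : forall i,
     different_exponent (P i) (finite_place (alpha i)) (delta i)) :
  ((forall m, (m < (p ^ n).-1)%N -> 2 <= boseck p n delta lambda m) ->
     forall i (a : nat), (1 <= a < p ^ n)%N -> gap (P i) a) /\
  ((exists2 m, (m < (p ^ n).-1)%N & boseck p n delta lambda m = 1) ->
     forall i (a : nat),
       (gap (P i) a /\ (a < p ^ n)%N) <->
       exists m, [/\ (m < (p ^ n).-1)%N, 2 <= boseck p n delta lambda m
         & a%:Z = rho p n delta lambda i m + 1]).
Proof.
split=> [G i a|_ i a].
  exact: (gap_all charp galF cycF degF alpha_inj ramE totram towL PlE stdL PE
    deltaE i G).
exact: (gap_boseck charp galF cycF degF alpha_inj ramE totram towL PlE stdL PE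
  deltaE i a).
Qed.
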